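(* In the setting described in the context, the iterative updates of the per-flow Q-factor $$\hat{\mathbb Q}_k^{t+1}(E_b,Q_k,\mathbf p)=\hat{\mathbb Q}_k^t(E_b,Q_k,\mathbf p)+\epsilon_t\big[F_k(\hat{\mathbb Q}_k^t,E_b,Q_k,\mathbf p)-F_k(\hat{\mathbb Q}_k^t,E_b^I,Q_k^I,\mathbf p^I)-\hat{\mathbb Q}_k^t(E_b,Q_k,\mathbf p)\big]$$ (for all $E_b\in\{0,\dots,N_E\}$, $Q_k\in\{0,\dots,N_Q\}$, $\mathbf p\in\boldsymbol{\mathcal P}$) and of the per-flow potential function $$\hat U_k^{t+1}(\widetilde E_b,\widetilde Q_k)=\hat U_k^t(\widetilde E_b,\widetilde Q_k)+\epsilon_t\big[T_k(\hat{\mathbf U}_k^t,\widetilde E_b,\widetilde Q_k)-T_k(\hat{\mathbf U}_k^t,\widetilde E_b^I,\widetilde Q_k^I)-\hat U_k^t(\widetilde E_b,\widetilde Q_k)\big]$$ (for all $\widetilde E_b\in\{0,\dots,N_E\}$, $\widetilde Q_k\in\{0,\dots,N_Q\}$) converge almost surely for every $k\in\mathcal K$: $\lim_{t\to\infty}\hat{\mathbb Q}_k^t=\hat{\mathbb Q}_k^\infty$ a.s. and $\lim_{t\to\infty}\hat{\mathbf U}_k^t=\hat{\mathbf U}_k^\infty$ a.s., where $\hat{\mathbb Q}_k^\infty$ and $\hat{\mathbf U}_k^\infty$ are the solutions of the per-flow fixed point equations $$\hat\theta_k+\hat{\mathbb Q}_k(E_b,Q_k,\mathbf p)=\hat g_k(E_b,Q_k,p_b)+\sum_{(E_b',Q_k')}\hat\Pr[(E_b',Q_k')|(E_b,Q_k),\mathbf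 p]\,\mathbb E^{\hat\Omega_p}[\hat{\mathbb Q}_k(E_b',Q_k',\mathbf p')]$$ and $$\hat\theta_k+\hat U_k(\widetilde E_b,\widetilde Q_k)=\sum_{(A^E_b,A^Q_k)}\Pr[A^E_b]\Pr[A^Q_k]\Big(\mathbb E^{\hat\Omega_p}[\hat g_k(E_b,Q_k,p_b)]+\sum_{(\widetilde E_b',\widetilde Q_k')}\mathbb E^{\hat\Omega_p}\big[\hat\Pr[(\widetilde E_b',\widetilde Q_k')|(E_b,Q_k),\mathbf p]\big]\hat U_k(\widetilde E_b',\widetilde Q_k')\Big),$$ respectively, where $E_b=\min\{\widetilde E_b+A^E_b,N_E\}$, $Q_k=\min\{\widetilde Q_k+A^Q_k,N_Q\}$ in the last equation.
   Context: **System.** There are $B$ base stations (BSs), each with $N_t$ antennas, and $K$ single-antenna mobile stations (MSs). $\mathcal B=\{1,\dots,B\}$ is partitioned into $N=B/N_t$ clusters $\mathcal B_1,\dots,\mathcal B_N$ of $N_t$ BSs each. The set $\mathcal K$ of MSs is the disjoint union of the sets $\mathcal K_b$ (MSs of BS $b$); below $b$ always denotes the BS with $k\in\mathcal K_b$. The fading vector from BS $b$ to MS $k$ is $\mathbf h_{k,b}(t)\in\mathcal H$, a finite subset of $\mathbb C^{N_t}$; its entries have mean 0 and variance 1, it is i.i.d. over slots $t$ and independent over $(k,b)$. Path gains $L_{k,b}$ and transmit powers $P_b$ are constants. $\mathbf H=\{\mathbf h_{k,b}:k\in\mathcal K_b,b\in\mathcal B\}$ is the CSI. BS-DTX (discontinuous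 transmission) actions are $\mathbf p=(p_b)\in\boldsymbol{\mathcal P}\subseteq\{0,1\}^B$, user scheduling actions are $\mathbf s=(s_k)\in\boldsymbol{\mathcal S}\subseteq\{0,1\}^K$. For $k\in\mathcal K_b$, $b\in\mathcal B_n$, the SINR is $\rho_k=P_k^{rx}/(N_0+I_k)$, with $P_k^{rx}=p_bP_bL_{k,b}\|\mathbf h_{k,b}^T\mathbf w_{k,b}\|^2s_k$ and $I_k=\sum_{n'\ne n}\sum_{b'\in\mathcal B_{n'}}p_{b'}P_{b'}L_{k,b'}\|\mathbf h_{k,b'}^T(\sum_{k'\in\mathcal K_{b'}}\mathbf w_{k',b'}s_{k'})\|^2$, where $N_0>0$ and the zero-forcing beamformers $\mathbf w_{k,b}$ solve $\sum_{k\in\mathcal K_b}\|\mathbf w_{k,b}\|^2s_k=p_b$ and $s_k\mathbf h_{k,b'}^T(\sum_{k'\in\mathcal K_{b'}}\mathbf w_{k',b'}s_{k'})=0$ for all $b'\in\mathcal B_n$, $b'\ne b$ (if several solutions, the one maximizing $\|\mathbf h_{k,b}^T\mathbf w_{k,b}\|^2$). A packet of MS $k$ is received in a slot iff $\rho_k\ge\delta_k$; there exists $(\mathbf H,\mathbf p,\mathbf s)$ with $\Pr[\rho_k(\mathbf H,\mathbf p,\mathbf s)\ge\delta_k]>0$. **Queues.** Data arrivals $A^Q_k(t)$ and renewable energy arrivals $A^E_b(t)$ are nonnegative-integer valued, i.i.d. over $t$, independent over $k$ and $b$, with means less than 1. With $x^+=\max\{x,0\}$, $Q_k\in\{0,\dots,N_Q\}$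 and $E_b\in\{0,\dots,N_E\}$ evolve by $Q_k(t+1)=\min\{[Q_k(t)-\mathbf I[\rho_k(t)\ge\delta_k]]^++A^Q_k(t),N_Q\}$, $E_b(t+1)=\min\{[E_b(t)-p_b(t)]^++A^E_b(t),N_E\}$. **Base policy.** A randomized base policy $\hat\Omega=(\hat\Omega_p,\hat\Omega_s)$ is fixed: $\hat\Omega_p$ is a probability distribution on $\boldsymbol{\mathcal P}$, and $\hat\Omega_s$ maps $\mathbf H$ to a probability distribution on $\boldsymbol{\mathcal S}$. With $\beta_k,\gamma_b>0$ and $f$ monotonically increasing, $\hat g_k(E_b,Q_k,p_b)=\beta_kf(Q_k)+\gamma_bp_b\mathbf I[E_b=0]\mathbb E[\hat\Pr[s_k=1|\mathbf H]]$, and $\hat\Pr[\,\cdot\,|(E_b,Q_k),\mathbf p]=\mathbb E[\mathbb E^{\hat\Omega_s}[\Pr[\,\cdot\,|(E_b,Q_k,\mathbf H),\mathbf p,\mathbf s]|\mathbf H]]$. In the fixed point equation for $\hat{\mathbb Q}_k$, $(E_b',Q_k')$ is the next state (after arrivals); in the one for $\hat U_k$, $(\widetilde E_b',\widetilde Q_k')$ is the post-decision state $([E_b-p_b]^+,[Q_k-\mathbf I[\rho_k\ge\delta_k]]^+)$ (before arrivals). **Updates.** Using the observed arrivals $A^E_b(t),A^Q_k(t)$, $$F_k(\hat{\mathbb Q}_k^t,E_b,Q_k,\mathbf p)=\hat g_k(E_b,Q_k,p_b)+\sum_{(E_b',Q_k')}\hat\Pr[(E_b',Q_k')|(E_b,Q_k),\mathbf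 p]\,\mathbb E^{\hat\Omega_p}\big[\hat{\mathbb Q}_k^t(\min\{E_b'+A^E_b(t),N_E\},\min\{Q_k'+A^Q_k(t),N_Q\},\mathbf p')\big],$$ where here $E_b'=[E_b-p_b]^+$, $Q_k'=[Q_k-\mathbf I[\rho_k\ge\delta_k]]^+$; and, with $E_b^t=\min\{\widetilde E_b+A^E_b(t),N_E\}$, $Q_k^t=\min\{\widetilde Q_k+A^Q_k(t),N_Q\}$, $$T_k(\hat{\mathbf U}_k^t,\widetilde E_b,\widetilde Q_k)=\mathbb E^{\hat\Omega_p}[\hat g_k(E_b^t,Q_k^t,p_b)]+\sum_{(\widetilde E_b',\widetilde Q_k')}\mathbb E^{\hat\Omega_p}\big[\hat\Pr[(\widetilde E_b',\widetilde Q_k')|(E_b^t,Q_k^t),\mathbf p]\big]\hat U_k^t(\widetilde E_b',\widetilde Q_k'),$$ where $\widetilde E_b'=[E_b^t-p_b]^+$, $\widetilde Q_k'=[Q_k^t-\mathbf I[\rho_k\ge\delta_k]]^+$. Reference states and action: $E_b^I=Q_k^I=\widetilde E_b^I=\widetilde Q_k^I=0$ and $p_b^I=1$ for all $b$. Initial values $\hat{\mathbb Q}_k^0,\hat{\mathbf U}_k^0$ are given. Step sizes satisfy $\epsilon_t\ge0$, $\sum_t\epsilon_t=\infty$, $\sum_t\epsilon_t^2<\infty$.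
   Formalization: Added: under the base policy, A^Q_k>0 or service of MS k has positive probability, and A^E_b>0 or p_b=1 has positive probability; otherwise a queue is frozen and the fixed point equations have no solution (e.g. A^Q_k=0, MS k never scheduled) or no unique one up to constants. *)

(* Defs.v *)
(* MathComp / MathComp-Analysis, over an arbitrary [R : realType]. *)
From HB Require Import structures.
From mathcomp Require Import all_boot all_order all_algebra finmap.
From mathcomp Require Import complex.
From mathcomp Require Import all_classical all_reals all_analysis.

Set Implicit Arguments.
Unset Strict Implicit.
Unset Printing Implicit Defensive.

Import Order.TTheory GRing.Theory Num.Theory.
Import numFieldNormedType.Exports.
Local Open Scope classical_set_scope.
Local Open Scope ring_scope.

(* Probability distribution on the subset [A] of a finite type. *)
Definition is_distribution (R : realType) (I : finType) (A : {set I})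
    (mu : I -> R) : Prop :=
  [/\ forall x, 0 <= mu x, forall x, x \notin A -> mu x = 0
    & \sum_x mu x = 1].

(* Mutual independence of a family of random elements with values in a
   countable set (so that every subset of the codomain is measurable). *)
Definition mutually_independent (R : realType) (d : measure_display)
    (T : measurableType d) (P : probability T R) (I : eqType) (V : Type)
    (X : I -> T -> V) : Prop :=
  forall (s : seq I) (A : I -> set V), uniq s ->
    fine (P (\bigcap_(i in [set` s]) (X i @^-1` A i))) =
    \prod_(i <- s) fine (P (X i @^-1` A i)).

Definition sqmod (R : realType) (z : R[i]) : R :=
  complex.Re z ^+ 2 + complex.Im z ^+ 2.

Definition sqnorm (R : realType) (n : nat) (v : 'cV[R[i]]_n) : R :=
  \sum_i sqmod (v i 0).

Definition dotT (R : realType) (n : nat) (u v : 'cV[R[i]]_n) : R[i] :=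
  (u^T *m v) 0 0.

Record system (R : realType) := System {
  nBS : nat;
  nMS : nat;
  nCl : nat;
  nAnt : nat;
  (* cluster index of each BS and serving BS of each MS; the n-th cluster is
     the fibre of [cluster] over n, and K_b the fibre of [serving] over b *)
  cluster : 'I_nBS -> 'I_nCl;
  serving : 'I_nMS -> 'I_nBS;
  card_cluster : forall n, #|[set b | cluster b == n]%SET| = nAnt;
  fadings : {fset 'cV[R[i]]_nAnt};
  path_gain : 'I_nMS -> 'I_nBS -> R;
  power : 'I_nBS -> R;
  noise : R;
  noise_gt0 : 0 < noise;
  threshold : 'I_nMS -> R;
  dtx_actions : {set {ffun 'I_nBS -> bool}};
  sched_actions : {set {ffun 'I_nMS -> bool}};
  maxE : nat;
  maxQ : nat;
  beta : 'I_nMS -> R;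
  beta_gt0 : forall k, 0 < beta k;
  gamma : 'I_nBS -> R;
  gamma_gt0 : forall b, 0 < gamma b;
  qcost : nat -> R;
  qcost_homo : {homo qcost : m n / (m <= n)%N >-> m <= n}
}.

Definition csi (R : realType) (S : system R) : finType :=
  {ffun 'I_(nMS S) * 'I_(nBS S) -> fadings S}.
Definition dtx (R : realType) (S : system R) : finType :=
  {ffun 'I_(nBS S) -> bool}.
Definition sched (R : realType) (S : system R) : finType :=
  {ffun 'I_(nMS S) -> bool}.
(* An MS is only ever beamformed to by its serving BS, so a family of
   beamformers is indexed by the MS alone. *)
Definition beams (R : realType) (S : system R) : Type :=
  'I_(nMS S) -> 'cV[R[i]]_(nAnt S).
Definition battery (R : realType) (S : system R) : finType := 'I_(maxE S).+1.
Definition buffer (R : realType) (S : system R) : finType := 'I_(maxQ S).+1.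

Section Physical.
Variables (R : realType) (S : system R).
Implicit Types (h : csi S) (p : dtx S) (s : sched S) (W : beams S).
Implicit Types (k : 'I_(nMS S)) (b : 'I_(nBS S)).

Definition fading h k b : 'cV[R[i]]_(nAnt S) := val (h (k, b)).

Definition tx s W b : 'cV[R[i]]_(nAnt S) :=
  \sum_(k | serving k == b) (s k)%:R *: W k.

Definition beam_gain h W k : R := sqmod (dotT (fading h k (serving k)) (W k)).

(* The zero-forcing equations, grouped by the BS [b] whose beamformers they
   constrain: the power of b, and the nulling of the signal of b at the
   scheduled MSs of the other BSs of its cluster. *)
Definition zf_solution h p s b W : Prop :=
  \sum_(k | serving k == b) sqnorm (W k) * (s k)%:R = (p b)%:R /\
  forall k, serving k != b -> cluster (serving k) = cluster b ->
    (s k)%:R * dotT (fading h k b) (tx s W b) = 0.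

Definition zf_best h p s b W : Prop :=
  zf_solution h p s b W /\
  forall W', zf_solution h p s b W' ->
    forall k, serving k = b -> s k -> beam_gain h W' k <= beam_gain h W k.

(* The equations need not be solvable for every action (e.g. p_b = 1 while no
   MS of b is scheduled), nor need one solution maximize the gains of several
   MSs of b at once; nothing is required of [w] in such cases. *)
Definition zero_forcing (w : csi S -> dtx S -> sched S -> beams S) : Prop :=
  forall h p s b,
    ((exists W, zf_solution h p s b W) -> zf_solution h p s b (w h p s)) /\
    ((exists W, zf_best h p s b W) -> zf_best h p s b (w h p s)).

Definition rx_power h p s W k : R :=
  (p (serving k))%:R * power (serving k) * path_gain k (serving k)
  * beam_gain h W k * (s k)%:R.

Definition interference h p s W k : R :=
  \sum_(n' | n' != cluster (serving k)) \sum_(b' | cluster b' == n')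
    (p b')%:R * power b' * path_gain k b'
    * sqmod (dotT (fading h k b') (tx s W b')).

Definition sinr h p s W k : R :=
  rx_power h p s W k / (noise S + interference h p s W k).

Definition received (w : csi S -> dtx S -> sched S -> beams S) h p s k : bool :=
  threshold k <= sinr h p s (w h p s) k.

End Physical.

Record processes (R : realType) (d : measure_display) (T : measurableType d)
    (P : probability T R) (S : system R) := Processes {
  fade : 'I_(nMS S) -> 'I_(nBS S) -> nat -> T -> fadings S;
  arrQ : 'I_(nMS S) -> nat -> {RV P >-> nat};
  arrE : 'I_(nBS S) -> nat -> {RV P >-> nat};
  fade_meas : forall k b t x, measurable (fade k b t @^-1` [set x]);
  fade_indep : mutually_independent P
    (fun i : 'I_(nMS S) * 'I_(nBS S) * nat => fade i.1.1 i.1.2 i.2);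
  fade_iid : forall k b t x,
    P (fade k b t @^-1` [set x]) = P (fade k b 0 @^-1` [set x]);
  fade_mean0 : forall k b j,
    \sum_(x : fadings S)
       (fine (P (fade k b 0 @^-1` [set x])))%:C%C * val x j 0 = 0;
  fade_var1 : forall k b j,
    \sum_(x : fadings S)
       fine (P (fade k b 0 @^-1` [set x])) * sqmod (val x j 0) = 1;
  arr_indep : mutually_independent P
    (fun i : ('I_(nMS S) + 'I_(nBS S)) * nat =>
       match i.1 with
       | inl k => arrQ k i.2 : T -> nat
       | inr b => arrE b i.2 : T -> nat
       end);
  arrQ_iid : forall k t n,
    P (arrQ k t @^-1` [set n]) = P (arrQ k 0 @^-1` [set n]);
  arrE_iid : forall b t n,
    P (arrE b t @^-1` [set n]) = P (arrE b 0 @^-1` [set n]);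
  arrQ_mean : forall k, (\int[P]_x (arrQ k 0 x)%:R%:E < 1)%E;
  arrE_mean : forall b, (\int[P]_x (arrE b 0 x)%:R%:E < 1)%E
}.

Record base_policy (R : realType) (S : system R) := BasePolicy {
  pol_dtx : dtx S -> R;
  pol_sched : csi S -> sched S -> R;
  pol_dtx_distr : is_distribution (dtx_actions S) pol_dtx;
  pol_sched_distr : forall h, is_distribution (sched_actions S) (pol_sched h)
}.

Section PerFlow.
Variables (R : realType) (d : measure_display) (T : measurableType d).
Variables (P : probability T R) (S : system R) (X : processes P S).
Variable w : csi S -> dtx S -> sched S -> beams S.
Variable Om : base_policy S.
Implicit Types (h : csi S) (p : dtx S) (s : sched S) (k : 'I_(nMS S)).

Definition clipE (e : nat) : battery S := inord (minn e (maxE S)).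
Definition clipQ (q : nat) : buffer S := inord (minn q (maxQ S)).

Definition csi_prob h : R :=
  fine (P [set x | forall k b, fade X k b 0 x = h (k, b)]).

(* E[ E^{Om_s}[ phi(H, s) | H ] ] *)
Definition mean_csi_sched (phi : csi S -> sched S -> R) : R :=
  \sum_h csi_prob h * \sum_s pol_sched Om h s * phi h s.

Definition mean_dtx (phi : dtx S -> R) : R := \sum_p pol_dtx Om p * phi p.

Definition ghat k (e : battery S) (q : buffer S) p : R :=
  beta k * qcost S q
  + gamma (serving k) * (p (serving k))%:R * (e == 0%N :> nat)%:R
    * mean_csi_sched (fun _ s => (s k)%:R).

(* Truncated subtraction of [nat] is the positive part [.]^+. *)
Definition served_E k (e : nat) p : nat := (e - p (serving k))%N.
Definition served_Q k (q : nat) h p s : nat := (q - received w h p s k)%N.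

(* Pr-hat of the next state, after the arrivals of the slot. *)
Definition prob_next k (e : battery S) (q : buffer S) p
    (e' : battery S) (q' : buffer S) : R :=
  mean_csi_sched (fun h s => fine (P [set x |
    clipE (served_E k e p + arrE X (serving k) 0 x)%N = e' /\
    clipQ (served_Q k q h p s + arrQ X k 0 x)%N = q'])).

(* Pr-hat of the post-decision state, before the arrivals. *)
Definition prob_post k (e : battery S) (q : buffer S) p
    (e' : battery S) (q' : buffer S) : R :=
  mean_csi_sched (fun h s =>
    ((served_E k e p == e' :> nat) && (served_Q k q h p s == q' :> nat))%:R).

Definition Qfactor : Type := battery S -> buffer S -> dtx S -> R.
Definition potential : Type := battery S -> buffer S -> R.

(* [aE] and [aQ] are the arrivals observed at BS b and MS k in the slot. *)
Definition F_op k (aE aQ : nat) (Q : Qfactor) (e : battery S) (q : buffer S) p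
    : R :=
  ghat k e q p
  + \sum_(e' : battery S) \sum_(q' : buffer S) prob_post k e q p e' q'
      * mean_dtx (fun p' => Q (clipE (e' + aE)%N) (clipQ (q' + aQ)%N) p').

Definition T_op k (aE aQ : nat) (U : potential) (e : battery S) (q : buffer S)
    : R :=
  let et := clipE (e + aE)%N in
  let qt := clipQ (q + aQ)%N in
  mean_dtx (fun p => ghat k et qt p)
  + \sum_(e' : battery S) \sum_(q' : buffer S)
      mean_dtx (fun p => prob_post k et qt p e' q') * U e' q'.

Definition refE : battery S := ord0.
Definition refQ : buffer S := ord0.
Definition refp : dtx S := [ffun=> true].

Fixpoint Q_iter (eps : nat -> R) k (aE aQ : nat -> nat) (Q0 : Qfactor)
    (t : nat) : Qfactor :=
  if t is t'.+1 then
    let Q := Q_iter eps k aE aQ Q0 t' in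
    fun e q p => Q e q p + eps t' *
      (F_op k (aE t') (aQ t') Q e q p
       - F_op k (aE t') (aQ t') Q refE refQ refp - Q e q p)
  else Q0.

Fixpoint U_iter (eps : nat -> R) k (aE aQ : nat -> nat) (U0 : potential)
    (t : nat) : potential :=
  if t is t'.+1 then
    let U := U_iter eps k aE aQ U0 t' in
    fun e q => U e q + eps t' *
      (T_op k (aE t') (aQ t') U e q
       - T_op k (aE t') (aQ t') U refE refQ - U e q)
  else U0.

Definition Q_fixed_point k (theta : R) (Q : Qfactor) : Prop :=
  forall e q p, p \in dtx_actions S ->
    theta + Q e q p =
    ghat k e q p
    + \sum_(e' : battery S) \sum_(q' : buffer S) prob_next k e q p e' q'
        * mean_dtx (fun p' => Q e' q' p').

Definition probE k (a : nat) : R :=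
  fine (P (arrE X (serving k) 0 @^-1` [set a])).
Definition probQ k (a : nat) : R := fine (P (arrQ X k 0 @^-1` [set a])).

(* The summand in the arrivals is exactly [T_op] at these arrivals. *)
Definition U_fixed_point k (theta : R) (U : potential) : Prop :=
  forall e q,
    ((theta + U e q)%:E =
     \sum_(0 <= aE <oo) \sum_(0 <= aQ <oo)
       (probE k aE * probQ k aQ * T_op k aE aQ U e q)%:E)%E.

Definition servable k : Prop :=
  exists h p s, [/\ p \in dtx_actions S, s \in sched_actions S,
    0 < csi_prob h & received w h p s k].

(* Neither queue of the flow is frozen under the base policy: the data queue
   has arrivals or is served, and the energy queue has arrivals or is drained.
   A frozen queue keeps its initial value for ever, so that the per-flow chain
   has several recurrent classes; if the data queue is frozen these have
   different average costs in general, and no constant theta satisfies the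
   fixed point equations. *)
Definition not_frozen k : Prop :=
  ((0 < P [set x | (0 < arrQ X k 0 x)%N])%E \/
   0 < mean_dtx (fun p =>
         mean_csi_sched (fun h s => (received w h p s k)%:R))) /\
  ((0 < P [set x | (0 < arrE X (serving k) 0 x)%N])%E \/
   0 < mean_dtx (fun p => (p (serving k))%:R)).

End PerFlow.

(* Main.v *)
Require Import Defs.
From HB Require Import structures.
From mathcomp Require Import all_boot all_order all_algebra finmap.
From mathcomp Require Import complex.
From mathcomp Require Import all_classical all_reals all_analysis.
From mathcomp Require Import measurable_realfun.
From mathcomp Require Import zify ring lra.

Set Implicit Arguments.
Unset Strict Implicit.
Unset Printing Implicit Defensive.

Import Order.TTheory GRing.Theory Num.Theory.
Import numFieldNormedType.Exports.
Local Open Scope classical_set_scope.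
Local Open Scope ring_scope.

(* Both updates have the form x' = x + e_t H_(c_t)(x), where the affine maps H_c
   are indexed by the finitely many values c of the clipped arrivals and the
   c_t are i.i.d. The scalar series sum_t e_t (1[c_t = c] - p_c) converge almost
   surely by Kolmogorov's maximal inequality; on that event the rest is
   deterministic. If s_t(c) is the tail of the series, then the corrected error
   z_t = x_t - x* + sum_c s_t(c) H_c(x_t) satisfies
   z_(t+1) = z_t + e_t (A z_t + o(1 + |z_t|)) with A the mean linear part, so
   no martingale argument is needed. A contracts the Lyapunov function
   N(z) + |z(i0)|, i0 the reference state: A acts on the value at i0 as -1, and
   N = sum_(l <= n) osc o M^l, with M the lazy mean chain, contracts because some
   state is reachable from all the others. The latter holds since neither queue
   is frozen: each of them can be driven monotonically to one of its ends while
   the other one idles. *)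

(** * A seminorm contracted by a unichain Markov operator *)

Section Seminorms.
Variables (R : realFieldType) (I : finType).
Implicit Types (x y : I -> R).

Definition supnorm x : R := \big[Num.max/0]_i `|x i|.
Definition osc x : R := \big[Num.max/0]_(u : I * I) (x u.1 - x u.2).

Lemma le_supnorm x i : `|x i| <= supnorm x.
Proof. by rewrite /supnorm; apply: (le_bigmax _ (fun i => `|x i|)). Qed.

Lemma supnorm_le x b : 0 <= b -> (forall i, `|x i| <= b) -> supnorm x <= b.
Proof. by move=> b0 xb; apply: bigmax_le. Qed.

Lemma supnorm_ge0 x : 0 <= supnorm x.
Proof. exact: bigmax_ge_id. Qed.

Lemma le_osc x i j : x i - x j <= osc x.
Proof. exact: (le_bigmax _ (fun u : I * I => x u.1 - x u.2) (i, j)). Qed.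

Lemma osc_le x b : 0 <= b -> (forall i j, x i - x j <= b) -> osc x <= b.
Proof. by move=> b0 xb; apply: bigmax_le. Qed.

Lemma osc_ge0 x : 0 <= osc x.
Proof. exact: bigmax_ge_id. Qed.

Lemma osc_le_supnorm x : osc x <= 2 * supnorm x.
Proof.
apply: osc_le => [|i j]; first by rewrite mulr_ge0 // supnorm_ge0.
have := le_supnorm x i; have := le_supnorm x j.
by rewrite !ler_norml => /andP[? ?] /andP[? ?]; lra.
Qed.

Lemma osc_comb x y a b c : 0 <= a -> 0 <= b ->
  osc (fun i => a * x i + b * y i + c) <= a * osc x + b * osc y.
Proof.
move=> a0 b0; apply: osc_le => [|i j].
  by rewrite addr_ge0 // mulr_ge0 // osc_ge0.
have -> : a * x i + b * y i + c - (a * x j + b * y j + c) =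
  a * (x i - x j) + b * (y i - y j) by ring.
by rewrite lerD // ler_wpM2l // le_osc.
Qed.

End Seminorms.

Section Averaging.
Variables (R : realFieldType) (I A : finType) (m : A -> R) (f : A -> I -> I).
Hypothesis m_ge0 : forall a, 0 <= m a.
Hypothesis m_sum1 : \sum_a m a = 1.
Implicit Types (x y : I -> R).

Definition average x : I -> R := fun i => \sum_a m a * x (f a i).
Definition lazy x : I -> R := fun i => (x i + average x i) / 2.
Definition step : rel I := [rel i j | [exists a, (0 < m a) && (f a i == j)]].

Lemma average_comb x y a b c :
  average (fun i => a * x i + b * y i + c) =
  (fun i => a * average x i + b * average y i + c).
Proof.
apply/funext => i; rewrite /average !mulr_sumr -[c in RHS]mul1r -m_sum1.
by rewrite mulr_suml -!big_split /=; apply: eq_bigr => u _; ring.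
Qed.

Lemma averageD x y i :
  average (fun j => x j + y j) i = average x i + average y i.
Proof. by rewrite -big_split /=; apply: eq_bigr => a _; rewrite mulrDr. Qed.

Lemma averageB x y i :
  average (fun j => x j - y j) i = average x i - average y i.
Proof. by rewrite -sumrB; apply: eq_bigr => a _; rewrite mulrBr. Qed.

Lemma average_ge x b i : (forall i, b <= x i) -> b <= average x i.
Proof.
move=> bx; rewrite -[b]mul1r -m_sum1 mulr_suml /average.
by apply: ler_sum => a _; rewrite ler_wpM2l.
Qed.

Lemma average_le x b i : (forall i, x i <= b) -> average x i <= b.
Proof.
move=> xb; rewrite -[b]mul1r -m_sum1 mulr_suml /average.
by apply: ler_sum => a _; rewrite ler_wpM2l.
Qed.

Lemma norm_average_le x i : `|average x i| <= supnorm x.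
Proof.
rewrite ler_norml; apply/andP; split; [apply: average_ge|apply: average_le];
  by move=> j; have := le_supnorm x j; rewrite ler_norml => /andP[].
Qed.

Lemma lazy_comb x y a b c :
  lazy (fun i => a * x i + b * y i + c) =
  (fun i => a * lazy x i + b * lazy y i + c).
Proof. by apply/funext => i; rewrite /lazy average_comb; lra. Qed.

Lemma iter_lazy_comb n x y a b c :
  iter n lazy (fun i => a * x i + b * y i + c) =
  (fun i => a * iter n lazy x i + b * iter n lazy y i + c).
Proof. by elim: n => //= n ->; rewrite lazy_comb. Qed.

Lemma iter_lazy_ge0 n x : (forall i, 0 <= x i) -> forall i, 0 <= iter n lazy x i.
Proof.
move=> x0; elim: n => //= n IHn i.
by rewrite /lazy divr_ge0 // addr_ge0 // average_ge.
Qed.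

Lemma osc_lazy x : osc (lazy x) <= osc x.
Proof.
apply: osc_le => [|i j]; first exact: osc_ge0.
have h1 : average x i <= x j + osc x.
  by apply: average_le => u; rewrite -lerBlDl; exact: le_osc.
have h2 : x i - osc x <= average x j.
  by apply: average_ge => u; rewrite lerBlDl -lerBlDr; exact: le_osc.
by rewrite /lazy; lra.
Qed.

Lemma osc_iter_lazy n x : osc (iter n lazy x) <= osc x.
Proof. by elim: n => //= n; apply: le_trans; exact: osc_lazy. Qed.

Variable j0 : I.
Hypothesis reach_j0 : forall i, connect step i j0.

Let charges n i := exists2 e : R, 0 < e &
  forall x, (forall i, 0 <= x i) -> e * x j0 <= iter n lazy x i.

Let chargesS n i : charges n i -> charges n.+1 i.
Proof.
move=> [e e0 He]; exists (e / 2) => [|x x0]; first by rewrite divr_gt0.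
have := He x x0; have : 0 <= average (iter n lazy x) i.
  by apply: average_ge; exact: iter_lazy_ge0.
by rewrite /= /lazy; lra.
Qed.

Let charges_step n i j : step i j -> charges n j -> charges n.+1 i.
Proof.
move=> /existsP[a /andP[ma /eqP fa]] [e e0 He].
exists (m a * e / 2) => [|x x0]; first by rewrite divr_gt0 // mulr_gt0.
rewrite /= /lazy; have hi := iter_lazy_ge0 n x0.
have : m a * iter n lazy x j <= average (iter n lazy x) i.
  rewrite /average (bigD1 a) //= fa lerDl sumr_ge0 // => b _.
  by rewrite mulr_ge0.
have : m a * (e * x j0) <= m a * iter n lazy x j by rewrite ler_wpM2l ?He.
by have := hi i; lra.
Qed.

Lemma lazy_charges : exists n, exists2 e : R, 0 < e <= 1 &
  forall x, (forall i, 0 <= x i) -> forall i, e * x j0 <= iter n lazy x i.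
Proof.
have ex1 i : exists n, charges n i.
  have /connectP[s] := reach_j0 i.
  elim: s i => [i _ /= <-|j s IHs i /= /andP[sij] sj /(IHs _ sj)[n Hn]].
    by exists 0%N; exists 1 => // x _; rewrite mul1r.
  by exists n.+1; exact: charges_step Hn.
have {ex1}[nn Hnn] := fin_all_exists ex1.
pose n := (\max_i nn i)%N.
have ex2 i : exists e : R, 0 < e /\
    forall x, (forall i, 0 <= x i) -> e * x j0 <= iter n lazy x i.
  have : charges n i.
    have : (nn i <= n)%N by rewrite /n (leq_bigmax i).
    move=> /subnKC <-; elim: (n - nn i)%N => [|u IHu]; first by rewrite addn0.
    by rewrite addnS; exact: chargesS.
  by case=> e e0 He; exists e.
have {ex2}[ee Hee] := fin_all_exists ex2.
exists n; exists (\big[Num.min/1]_i ee i).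
  by rewrite bigmin_le_id andbT; apply: lt_bigmin => // i _; have [] := Hee i.
move=> x x0 i; have [_ /(_ x x0)] := Hee i; apply: le_trans.
by rewrite ler_wpM2r // bigmin_le_cond.
Qed.

Lemma contracting_seminorm : exists (N : (I -> R) -> R) (kap C : R),
  [/\ 0 < kap <= 1, 0 <= C, forall x, osc x <= N x,
    forall x, N x <= C * supnorm x &
   (forall x y a b c, 0 <= a -> 0 <= b ->
     N (fun i => a * x i + b * y i + c) <= a * N x + b * N y) /\
   forall e x, 0 <= e <= 1 / 2 ->
     N (fun i => x i + e * (average x i - x i)) <= (1 - kap * e) * N x].
Proof.
have [n [eta /andP[eta0 eta1] Heta]] := lazy_charges.
have osc_n x : osc (iter n lazy x) <= (1 - eta) * osc x.
  apply: osc_le => [|i j]; first by rewrite mulr_ge0 ?osc_ge0 // subr_ge0.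
  have key (c u : R) v : (forall i, 0 <= c * x i + u) ->
      eta * (c * x j0 + u) <= c * iter n lazy x v + u.
    move=> /Heta /(_ v).
    have := iter_lazy_comb n x (fun=> 0) c 0 u.
    under eq_fun do rewrite mul0r addr0.
    by under [X in _ = X -> _]eq_fun do rewrite mul0r addr0; move=> ->.
  pose M := \big[Num.max/x j0]_i x i; pose L := \big[Num.min/x j0]_i x i.
  have ML : M - L <= osc x.
    have [u _ ->] : exists2 u, true & M = x u.
      by rewrite /M; elim/big_ind: _ => [|_ _ [u _ ->] [v _ ->]|u _];
        [exists j0|case: (leP (x u) (x v)) => _; [exists v|exists u]|exists u].
    have [v _ ->] : exists2 u, true & L = x u.
      by rewrite /L; elim/big_ind: _ => [|_ _ [u' _ ->] [v _ ->]|v _];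
        [exists j0|case: (leP (x u') (x v)) => _; [exists u'|exists v]|exists v].
    exact: le_osc.
  have hM : eta * (-1 * x j0 + M) <= -1 * iter n lazy x i + M.
    by apply: key => u; rewrite mulN1r addrC subr_ge0; apply: le_bigmax.
  have hL : eta * (1 * x j0 - L) <= 1 * iter n lazy x j - L.
    by apply: key => u; rewrite mul1r subr_ge0; apply: bigmin_le_cond.
  have : (1 - eta) * (M - L) <= (1 - eta) * osc x.
    by rewrite ler_wpM2l // subr_ge0.
  lra.
pose N x := \sum_(l < n.+1) osc (iter l lazy x).
have N_comb x y a b c : 0 <= a -> 0 <= b ->
     N (fun i => a * x i + b * y i + c) <= a * N x + b * N y.
  move=> a0 b0; rewrite /N !mulr_sumr -big_split /=.
  by apply: ler_sum => l _; rewrite iter_lazy_comb; exact: osc_comb.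
have N_le x : N x <= n.+1%:R * osc x.
  rewrite /N (le_trans (ler_sum _ (fun (l : 'I__) _ => osc_iter_lazy l x))) //.
  by rewrite sumr_const card_ord mulr_natl.
have osc_N x : osc x <= N x.
  by rewrite /N big_ord_recl /= lerDl sumr_ge0 // => l _; exact: osc_ge0.
have N_lazy x : N (lazy x) <= (1 - eta / n.+1%:R) * N x.
  have -> : N (lazy x) = N x - osc x + osc (iter n.+1 lazy x).
    rewrite /N [in RHS]big_ord_recl /= [osc x + _]addrC addrK.
    rewrite big_ord_recr /= -iterSr /=; congr (_ + _).
    by apply: eq_bigr => l _; rewrite -iterSr.
  have h1 := le_trans (osc_lazy _ : osc (iter n.+1 lazy x) <= _) (osc_n x).
  have : eta / n.+1%:R * N x <= eta * osc x.
    by rewrite mulrAC -mulrA ler_pM2l // mulrC ler_pdivrMl ?ltr0n.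
  by move: (eta / _) => r; nra.
exists N, (eta / n.+1%:R), (n.+1%:R * 2); split=> //.
- rewrite divr_gt0 //= ler_pdivrMr ?ltr0n // mul1r (le_trans eta1) //.
  by rewrite ler1n.
- by move=> x; rewrite (le_trans (N_le x)) // -mulrA ler_wpM2l // osc_le_supnorm.
split=> // e x /andP[e0 e1].
have -> : (fun i => x i + e * (average x i - x i)) =
  (fun i => (1 - 2 * e) * x i + (2 * e) * lazy x i + 0).
  by apply/funext => i; rewrite /lazy; lra.
apply: le_trans (N_comb _ _ _ _ _ _ _) _; try lra.
have h0 : 0 <= N x by rewrite (le_trans (osc_ge0 x)).
have : (2 * e) * N (lazy x) <= (2 * e) * ((1 - eta / n.+1%:R) * N x).
  by rewrite ler_wpM2l //; lra.
have : 0 <= e * ((eta / n.+1%:R) * N x).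
  by rewrite !mulr_ge0 // ?invr_ge0 // ltW.
by move: (eta / _) => r; nra.
Qed.

End Averaging.

(** * The Poisson equation *)

Section Poisson.
Variables (R : realFieldType) (I A : finType) (m : A -> R) (f : A -> I -> I).
Hypothesis m_ge0 : forall a, 0 <= m a.
Hypothesis m_sum1 : \sum_a m a = 1.
Variables (i0 j0 : I).
Hypothesis reach_j0 : forall i, connect (step m f) i j0.

Let harmonic_eq0 (x : I -> R) :
  (forall i, average m f x i - average m f x i0 - x i = 0) -> forall i, x i = 0.
Proof.
move=> x0.
have [N [kap [K [/andP[kap0 _] _ oscN _ [N_comb N_contr]]]]] :=
  contracting_seminorm m_ge0 m_sum1 reach_j0.
have xi0 : x i0 = 0 by have := x0 i0; lra.
have Nx : N x <= (1 - kap * (1 / 2)) * N x.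
  apply: le_trans (N_contr (1 / 2) x _); last lra.
  set c := average m f x i0; set x' := fun i => _.
  have -> : x = (fun i => 1 * x' i + 0 * 0 + - (c / 2)).
    by apply/funext => i; rewrite /x'; have := x0 i; rewrite -/c; lra.
  by apply: le_trans (N_comb _ _ _ _ _ _ _) _; rewrite // mul1r mul0r addr0.
have N0 : 0 <= N x by apply: le_trans (oscN x); exact: osc_ge0.
have {}N0 : N x <= 0 by nra.
move=> i; apply/eqP; rewrite eq_le -{1 2}xi0.
by apply/andP; split; rewrite -subr_le0 (le_trans (le_osc _ _ _)) // (le_trans
  (oscN x)).
Qed.

Lemma poisson_solvable (h : I -> R) : exists (theta : R) (x : I -> R),
  x i0 = 0 /\ forall i, theta + x i = h i + average m f x i.
Proof.
pose M : 'M[R]_#|I| := \matrix_(k, l)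
  (\sum_a m a * (f a (enum_val l) == enum_val k)%:R
   - \sum_a m a * (f a i0 == enum_val k)%:R - (l == k)%:R).
pose vec (u : 'rV[R]_#|I|) i := u 0 (enum_rank i).
have expand (u : 'rV[R]_#|I|) (j : I) :
    \sum_k u 0 k * (j == enum_val k)%:R = vec u j.
  rewrite (bigD1 (enum_rank j)) //= enum_rankK eqxx mulr1 big1 ?addr0 // => k kj.
  by rewrite -[j]enum_rankK (inj_eq enum_val_inj) eq_sym (negbTE kj) mulr0.
have expand_avg (u : 'rV[R]_#|I|) j :
    \sum_k u 0 k * (\sum_a m a * (f a j == enum_val k)%:R) = average m f (vec
      u) j.
  under eq_bigr => k _ do rewrite mulr_sumr.
  rewrite exchange_big /=; apply: eq_bigr => a _.
  by rewrite -expand mulr_sumr; apply: eq_bigr => k _; rewrite mulrCA.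
have ME (u : 'rV[R]_#|I|) i : (u *m M) 0 (enum_rank i) =
    average m f (vec u) i - average m f (vec u) i0 - vec u i.
  rewrite mxE; under eq_bigr => k _ do rewrite mxE mulrBr mulrBr enum_rankK.
  rewrite !sumrB !expand_avg; congr (_ - _); rewrite -expand.
  by apply: eq_bigr => k _; rewrite -(inj_eq enum_val_inj) enum_rankK.
have M_unit : M \in unitmx.
  rewrite -row_free_unit; apply: inj_row_free => v vM0.
  apply/rowP => k; rewrite mxE -[k]enum_valK;
    apply: (harmonic_eq0 (x := vec v)) => i.
  by rewrite -ME vM0 mxE.
pose b : 'rV[R]_#|I| := \row_k (h i0 - h (enum_val k)).
pose x := vec (b *m invmx M).
have xE i : average m f x i - average m f x i0 - x i = h i0 - h i.
  by rewrite -ME mulmxKV // mxE enum_rankK.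
exists (h i0 + average m f x i0), x; split; first by have := xE i0; lra.
by move=> i; have := xE i; lra.
Qed.

End Poisson.

(** * Relative value iteration driven by a convergent noise series *)

Lemma perturbed_contraction_cvg0 (R : realType) (W del eps : nat -> R) (kap : R) :
  0 < kap -> (forall t, 0 <= W t) -> (forall t, 0 <= eps t) ->
  eps @ \oo --> 0 -> (forall M, exists n, M <= \sum_(0 <= t < n) eps t) ->
  del @ \oo --> 0 ->
  (\forall t \near \oo,
     W t.+1 <= (1 - kap * eps t) * W t + eps t * (del t * (1 + W t))) ->
  W @ \oo --> 0.
Proof.
move=> kap0 W0 eps0 eps_cvg eps_sum del_cvg Wstep.
apply/cvgrPdist_le => eta eta0.
pose d := kap * eta / (2 * (1 + eta)).
have d0 : 0 < d by rewrite /d divr_gt0 // ?mulr_gt0 //; lra.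
have dE : d * (1 + eta) = kap * eta / 2 by rewrite /d; field; lra.
have [N _ HN] : \forall t \near \oo, [/\ `|del t| <= d, kap * eps t <= 1 / 2 &
    W t.+1 <= (1 - kap * eps t) * W t + eps t * (del t * (1 + W t))].
  have hd : \forall t \near \oo, `|del t| <= d by apply: cvgr0_norm_le.
  have he : \forall t \near \oo, `|eps t| <= 1 / 2 / kap.
    by apply: cvgr0_norm_le => //; rewrite divr_gt0.
  near=> t; split; [by near: t| |by near: t].
  have : `|eps t| <= 1 / 2 / kap by near: t.
  by rewrite ger0_norm // ler_pdivlMr // mulrC.
have dkap : d <= kap / 2 by rewrite /d ler_pdivrMr; [nra|lra].
have drift t : (N <= t)%N ->
    W t.+1 <= W t - eps t * (kap * W t - d * (1 + W t)).
  move=> /HN[]; rewrite ler_norml => /andP[_ hd] _ /le_trans; apply.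
  have : del t * (1 + W t) <= d * (1 + W t).
    by rewrite ler_wpM2r // addr_ge0.
  have := eps0 t; nra.
have low t : (N <= t)%N -> W t <= eta -> W t.+1 <= eta.
  move=> Nt Wt; apply: le_trans (drift t Nt) _.
  have [_ ke _] := HN t Nt.
  have h0 := eps0 t.
  have hd : 0 <= eps t * d by rewrite mulr_ge0 // ltW.
  have h1 : 0 <= (eta - W t) * (1 - eps t * (kap - d)) by rewrite mulr_ge0; lra.
  have h2 : eps t * (d * (1 + eta)) = eps t * (kap * eta / 2) by rewrite dE.
  have h3 : 0 <= eps t * (kap * eta).
    by rewrite mulr_ge0 // mulr_ge0 // ltW.
  lra.
have high t : (N <= t)%N -> eta < W t -> W t.+1 <= W t - eps t * (kap * eta / 2).
  move=> Nt Wt; apply: le_trans (drift t Nt) _.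
  rewrite lerD2l lerN2 ler_wpM2l // -[leLHS]/(kap * eta / 2).
  have : 0 <= (W t - eta) * (kap - d) by rewrite mulr_ge0; lra.
  lra.
have [T NT WT] : exists2 t, (N <= t)%N & W t <= eta.
  apply: contrapT => none.
  have WN t : (N <= t)%N -> eta < W t.
    by move=> Nt; rewrite ltNge; apply/negP => Wt; apply: none; exists t.
  pose c := kap * eta / 2.
  have c0 : 0 < c by rewrite /c divr_gt0 // mulr_gt0.
  have down n : W (N + n)%N <= W N - c * \sum_(N <= t < N + n) eps t.
    elim: n => [|n IHn]; first by rewrite addn0 big_geq // mulr0 subr0.
    rewrite addnS big_nat_recr ?leq_addr //=.
    have := high (N + n)%N (leq_addr _ _) (WN _ (leq_addr _ _)).
    rewrite -/c; lra.
  have [n Hn] := eps_sum (\sum_(0 <= t < N) eps t + W N / c).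
  have : \sum_(0 <= t < n) eps t <= \sum_(0 <= t < N + n) eps t.
    rewrite addnC [leRHS](big_cat_nat (n := n)) //= ?leq_addr // lerDl.
    by apply: sumr_ge0.
  rewrite [leRHS](big_cat_nat (n := N)) //= ?leq_addr // => h.
  have : W N / c <= \sum_(N <= t < N + n) eps t by lra.
  rewrite ler_pdivrMr // mulrC => h2.
  have := down n; have := WN (N + n)%N (leq_addr _ _); lra.
exists T => // t /= Tt; rewrite sub0r normrN ger0_norm //.
elim: t Tt => [|t IHt]; first by rewrite leqn0 => /eqP <-.
rewrite leq_eqVlt => /predU1P[<- //|Tt].
by apply: low; [exact: leq_trans NT _|exact: IHt].
Unshelve. all: by end_near.
Qed.

Section StochasticApproximation.
Variables (R : realType) (I C Om : finType) (i0 j0 : I).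
Variables (p : C -> R) (mu : Om -> R) (phi : C -> Om -> I -> I).
Variable g : C -> I -> R.
Hypotheses (p_ge0 : forall c, 0 <= p c) (p_sum1 : \sum_c p c = 1).
Hypotheses (mu_ge0 : forall a, 0 <= mu a) (mu_sum1 : \sum_a mu a = 1).

Definition backup c (x : I -> R) i : R := g c i + average mu (phi c) x i.

Definition joint_weight (u : C * Om) : R := p u.1 * mu u.2.
Definition joint_move (u : C * Om) : I -> I := phi u.1 u.2.

Lemma joint_weight_ge0 u : 0 <= joint_weight u.
Proof. by rewrite mulr_ge0. Qed.

Lemma joint_weight_sum1 : \sum_u joint_weight u = 1.
Proof.
rewrite /joint_weight -(pair_bigA _ (fun c a => p c * mu a)) /=.
by under eq_bigr => c _ do rewrite -mulr_sumr mu_sum1 mulr1.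
Qed.

Lemma average_joint x i : average joint_weight joint_move x i =
  \sum_c p c * average mu (phi c) x i.
Proof.
rewrite /average /joint_weight /joint_move.
rewrite -(pair_bigA _ (fun c a => p c * mu a * x (phi c a i))) /=.
apply: eq_bigr => c _; rewrite mulr_sumr; apply: eq_bigr => a _.
by rewrite mulrA.
Qed.

Let H c (x : I -> R) i := backup c x i - backup c x i0 - x i.
Let L (P : (I -> R) -> I -> R) (x : I -> R) i := P x i - P x i0 - x i.

Let norm_L (A : finType) (m : A -> R) f x i : (forall a, 0 <= m a) ->
  \sum_a m a = 1 -> `|L (average m f) x i| <= 3 * supnorm x.
Proof.
move=> m0 m1; rewrite /L.
have := norm_average_le f m0 m1 x i; have := norm_average_le f m0 m1 x i0.
have := le_supnorm x i; rewrite !ler_norml.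
by move=> /andP[? ?] /andP[? ?] /andP[? ?]; lra.
Qed.

Let HB c x x' i :
  H c x i - H c x' i = L (average mu (phi c)) (fun j => x j - x' j) i.
Proof.
rewrite /H /L /backup !(fun i => averageB mu (phi c) x x' i); ring.
Qed.

Hypothesis reach_j0 : forall i, connect (step joint_weight joint_move) i j0.

Variables (theta : R) (xs : I -> R) (eps : nat -> R) (cc : nat -> C).
Variable x : nat -> I -> R.
Hypothesis poisson : forall i, theta + xs i = \sum_c p c * backup c xs i.
Hypothesis xs_ref : xs i0 = 0.
Hypothesis eps_ge0 : forall t, 0 <= eps t.
Hypothesis eps_cvg0 : eps @ \oo --> 0.
Hypothesis eps_sum : forall M, exists n, M <= \sum_(0 <= t < n) eps t.
Hypothesis noise_cvg : forall c,
  cvgn (fun n => \sum_(0 <= t < n) eps t * ((cc t == c)%:R - p c)).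
Hypothesis x_step : forall t i, x t.+1 i = x t i + eps t *
  (backup (cc t) (x t) i - backup (cc t) (x t) i0 - x t i).

Let S c n := \sum_(0 <= t < n) eps t * ((cc t == c)%:R - p c).
Let sig t c := limn (S c) - S c t.
Let s t := \sum_c `|sig t c|.
Let y t i := x t i - xs i.
Let d t i := \sum_c sig t c * H c (x t) i.
Let z t i := y t i + d t i.
Let P := average joint_weight joint_move.
Let r t i :=
  \sum_c sig t.+1 c * L (average mu (phi c)) (H (cc t) (x t)) i - L P (d t) i.
Let B := \sum_c supnorm (H c xs).

Let sigB t c : sig t c - sig t.+1 c = eps t * ((cc t == c)%:R - p c).
Proof. by rewrite /sig /S big_nat_recr //=; ring. Qed.

Let s_cvg0 : s @ \oo --> 0.
Proof.
have sc c : (fun t => `|sig t c|) @ \oo --> 0.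
  rewrite -(@normr0 _ R) -(subrr (limn (S c))).
  by apply: cvg_norm; apply: cvgB; [exact: cvg_cst|exact: noise_cvg].
have -> : 0 = \sum_(c : C) (0 : R) by rewrite big1.
by apply: (cvg_big add_continuous) => c _; exact: sc.
Qed.

Let s_ge0 t : 0 <= s t. Proof. exact: sumr_ge0. Qed.

Let mean_H w i : \sum_c p c * H c w i = L P (fun j => w j - xs j) i.
Proof.
have H0 : \sum_c p c * H c xs i = 0.
  rewrite /H; under eq_bigr => c _ do rewrite !mulrBr.
  by rewrite !sumrB -!poisson -mulr_suml p_sum1 xs_ref; ring.
rewrite -[LHS](subrK (\sum_c p c * H c xs i)) [X in _ + X]H0 addr0 -sumrB.
under eq_bigr => c _ do rewrite -mulrBr HB /L mulrBr mulrBr.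
by rewrite !sumrB -!average_joint -mulr_suml p_sum1 mul1r.
Qed.

Let z_step t i : z t.+1 i = z t i + eps t * (L P (z t) i + r t i).
Proof.
have dS : d t.+1 i - d t i = \sum_c sig t.+1 c * (H c (x t.+1) i - H c (x t) i) -
    (eps t * H (cc t) (x t) i - eps t * L P (y t) i).
  have <- : \sum_c eps t * (cc t == c)%:R * H c (x t) i = eps t * H (cc t) (x
    t) i.
    rewrite (bigD1 (cc t)) //= eqxx mulr1 big1 ?addr0 // => c cE.
    by rewrite eq_sym (negbTE cE) mulr0 mul0r.
  rewrite -mean_H /d mulr_sumr -!sumrB; apply: eq_bigr => c _.
  have -> : sig t c = sig t.+1 c + eps t * ((cc t == c)%:R - p c).
    by rewrite -sigB; ring.
  ring.
have xS c : H c (x t.+1) i - H c (x t) i =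
    eps t * L (average mu (phi c)) (H (cc t) (x t)) i.
  rewrite HB; have -> : (fun j => x t.+1 j - x t j) =
      (fun j => eps t * H (cc t) (x t) j + 0 * 0 + 0).
    by apply/funext => j; rewrite x_step /H; ring.
  by rewrite /L !(average_comb (phi c) mu_sum1 (H (cc t) (x t)) (fun=> 0)); ring.
have LPz : L P (z t) i = L P (y t) i + L P (d t) i.
  rewrite /L /P !averageD /z; ring.
rewrite LPz /r; move: dS; under eq_bigr => c _ do rewrite xS mulrCA.
rewrite -mulr_sumr /z => /eqP; rewrite subr_eq => /eqP ->.
by rewrite /y x_step -/(H (cc t) (x t) i); ring.
Qed.

Let norm_H t c i : `|H c (x t) i| <= B + 3 * supnorm (y t).
Proof.
have -> : H c (x t) i = H c xs i + (H c (x t) i - H c xs i) by ring.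
rewrite HB; apply: le_trans (ler_normD _ _) _; apply: lerD; last exact: norm_L.
rewrite (le_trans (le_supnorm _ i)) // /B (bigD1 c) //= lerDl.
by apply: sumr_ge0 => *; exact: supnorm_ge0.
Qed.

Let B_ge0 : 0 <= B.
Proof. by apply: sumr_ge0 => *; exact: supnorm_ge0. Qed.

Let Hbound_ge0 t : 0 <= B + 3 * supnorm (y t).
Proof. by rewrite addr_ge0 // mulr_ge0 // supnorm_ge0. Qed.

Let norm_d t i : `|d t i| <= s t * (B + 3 * supnorm (y t)).
Proof.
rewrite /d (le_trans (ler_norm_sum _ _ _)) // /s mulr_suml.
by apply: ler_sum => c _; rewrite normrM ler_wpM2l.
Qed.

Let norm_r t : supnorm (r t) <= 3 * (s t.+1 + s t) * (B + 3 * supnorm (y t)).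
Proof.
have b0 := Hbound_ge0 t.
apply: supnorm_le => [|i]; first by rewrite mulr_ge0 // mulr_ge0 // addr_ge0.
rewrite /r (le_trans (ler_normB _ _)) // [3 * (_ + _)]mulrDr mulrDl lerD //.
  rewrite (le_trans (ler_norm_sum _ _ _)) //.
  rewrite [3 * _]mulrC -mulrA /s mulr_suml.
  apply: ler_sum => c _; rewrite normrM ler_wpM2l //.
  rewrite (le_trans (norm_L _ _ _ _ _)) // ler_wpM2l //.
  by apply: supnorm_le.
rewrite (le_trans (norm_L _ _ _ joint_weight_ge0 joint_weight_sum1)) //.
by rewrite -mulrA ler_wpM2l // supnorm_le // mulr_ge0.
Qed.

Let y_le t : s t <= 1 / 6 -> supnorm (y t) <= 2 * supnorm (z t) + 2 * (s t * B).
Proof.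
move=> st; have st0 := s_ge0 t; have n0 := supnorm_ge0 (y t).
have : supnorm (y t) <= supnorm (z t) + s t * (B + 3 * supnorm (y t)).
  apply: supnorm_le => [|i].
    by rewrite addr_ge0 ?supnorm_ge0 // mulr_ge0.
  have -> : y t i = z t i - d t i by rewrite /z addrK.
  by rewrite (le_trans (ler_normB _ _)) // lerD // le_supnorm.
have : 0 <= (1 / 6 - s t) * supnorm (y t) by rewrite mulr_ge0 // subr_ge0.
lra.
Qed.

Lemma relative_value_iteration_cvg i : x t i @[t --> \oo] --> xs i.
Proof.
have [N [kap [K [/andP[kap0 kap1] K0 oscN N_le [N_comb N_contr]]]]] :=
  contracting_seminorm joint_weight_ge0 joint_weight_sum1 reach_j0.
pose W t := N (z t) + `|z t i0|.
have N0 w : 0 <= N w by rewrite (le_trans (osc_ge0 w)).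
have z_le t : supnorm (z t) <= W t.
  apply: supnorm_le => [|j]; first by rewrite addr_ge0.
  have -> : z t j = (z t j - z t i0) + z t i0 by rewrite subrK.
  rewrite (le_trans (ler_normD _ _)) // lerD // (le_trans _ (oscN _)) //.
  by rewrite ler_norml lerNl opprB !le_osc.
pose del t := (K + 1) * (3 * (s t.+1 + s t) * (4 * B + 6)).
have s_small : \forall t \near \oo, s t <= 1 / 6.
  have : \forall t \near \oo, `|s t| <= 1 / 6 by apply: cvgr0_norm_le.
  by apply: filterS => t; rewrite ger0_norm.
have eps_small : \forall t \near \oo, eps t <= 1 / 2.
  have : \forall t \near \oo, `|eps t| <= 1 / 2 by apply: cvgr0_norm_le.
  by apply: filterS => t; rewrite ger0_norm.
have W_cvg0 : W @ \oo --> 0.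
  apply: (perturbed_contraction_cvg0 (del := del) kap0 _ eps_ge0) => //.
  - by move=> t; rewrite addr_ge0.
  - rewrite -(mulr0 (K + 1)); apply: cvgMl_tmp.
    rewrite -(mul0r (4 * B + 6)); apply: cvgMr_tmp.
    rewrite -(mulr0 3); apply: cvgMl_tmp; rewrite -[0]addr0; apply: cvgD => //.
    by have := s_cvg0; rewrite -(cvg_shiftS s).
  near=> t.
  have st : s t <= 1 / 6 by near: t.
  have et : eps t <= 1 / 2 by near: t.
  have et0 := eps_ge0 t.
  have nr : supnorm (r t) <= 3 * (s t.+1 + s t) * (4 * B + 6) * (1 + W t).
    apply: le_trans (norm_r t) _; rewrite -[leRHS]mulrA ler_wpM2l //.
      by rewrite mulr_ge0 // addr_ge0.
    have := y_le st; have := z_le t; have := B_ge0.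
    have : 0 <= (1 / 6 - s t) * B by rewrite mulr_ge0 // subr_ge0.
    have : 0 <= B * W t by rewrite mulr_ge0 // addr_ge0.
    have : 0 <= supnorm (z t) by exact: supnorm_ge0.
    lra.
  have r0 := supnorm_ge0 (r t).
  have Nz : N (z t.+1) <= (1 - kap * eps t) * N (z t) + eps t * (K * supnorm (r
    t)).
    have -> : z t.+1 = (fun j => 1 * (z t j + eps t * (P (z t) j - z t j)) +
        eps t * r t j + (- eps t * P (z t) i0)).
      by apply/funext => j; rewrite z_step /L; ring.
    apply: le_trans (N_comb _ _ _ _ _ _ _) _ => //.
    rewrite mul1r lerD ?ler_wpM2l //; apply: N_contr.
    by rewrite et0 et.
  have zi0 : `|z t.+1 i0| <= (1 - kap * eps t) * `|z t i0| + eps t * supnorm (r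
    t).
    have -> : z t.+1 i0 = (1 - eps t) * z t i0 + eps t * r t i0.
      by rewrite z_step /L; ring.
    rewrite (le_trans (ler_normD _ _)) // lerD //.
      rewrite normrM ler_wpM2r // ger0_norm; last lra.
      by rewrite lerD2l lerN2 ler_piMl.
    by rewrite normrM ger0_norm // ler_wpM2l // le_supnorm.
  have : eps t * ((K + 1) * supnorm (r t)) <= eps t * (del t * (1 + W t)).
    by rewrite ler_wpM2l // /del -mulrA ler_wpM2l // addr_ge0.
  by rewrite /W; lra.
have bound_cvg0 : (fun t => 2 * W t + 2 * (s t * B)) @ \oo --> 0.
  have -> : 0 = 2 * 0 + 2 * (0 * B) :> R by ring.
  apply: cvgD; first exact: cvgMl_tmp.
  by apply: cvgMl_tmp; apply: cvgMr_tmp; exact: s_cvg0.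
apply/cvgrPdist_le => e e0; near=> t.
have st : s t <= 1 / 6 by near: t.
have be : `|2 * W t + 2 * (s t * B)| <= e by near: t; exact: cvgr0_norm_le.
rewrite distrC (le_trans (le_supnorm (y t) i)) // (le_trans (y_le st)) //.
rewrite (le_trans _ be) // (le_trans _ (ler_norm _)) // lerD2r ler_wpM2l //.
Unshelve. all: by end_near.
Qed.

End StochasticApproximation.

(** * Kolmogorov's maximal inequality *)

Section FinitePartition.
Variables (R : realType) (d : measure_display) (T : measurableType d).
Variables (P : probability T R) (C : finType).

Lemma fine_prob_partition (c : T -> C) (A : set T) :
  (forall v, measurable (c @^-1` [set v])) -> measurable A ->
  fine (P A) = \sum_v fine (P (A `&` c @^-1` [set v])).
Proof.
move=> mc mA.
rewrite [in LHS](_ : A = \bigcup_(v in [set` index_enum C]) (A `&` c @^-1` [set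
  v])); last first.
  apply/seteqP; split=> [x Ax|x [v _ []]//].
  by exists (c x); rewrite //= mem_index_enum.
rewrite measure_fin_bigcup //=; last 2 first.
- by move=> v w _ _ [x [[_ /= <-] [_ /= <-]]].
- by move=> v _; apply: measurableI.
rewrite -fsbig_seq ?index_enum_uniq // sum_fine // => v _.
rewrite fin_num_measure //.
exact: measurableI.
Qed.

Lemma measurable_fiberwise (c : T -> C) (F : C -> set T) :
  (forall v, measurable (c @^-1` [set v])) -> (forall v, measurable (F v)) ->
  measurable [set x | F (c x) x].
Proof.
move=> mc mF.
rewrite [X in measurable X](_ : _ =
    \bigcup_(v in [set: C]) (c @^-1` [set v] `&` F v)); last first.
  by apply/seteqP; split=> [x Fx|x [v _ [/= <-]]//]; exists (c x).
by apply: fin_bigcup_measurable => // v _; apply: measurableI.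
Qed.

End FinitePartition.

Section Kolmogorov.
Variables (R : realType) (d : measure_display) (T : measurableType d).
Variables (P : probability T R) (C : finType) (c : nat -> T -> C) (p : C -> R).
Hypothesis c_meas : forall t v, measurable (c t @^-1` [set v]).
Hypothesis c_indep : forall (l : seq nat) (u : nat -> C), uniq l ->
  fine (P (\bigcap_(i in [set` l]) (c i @^-1` [set u i]))) =
  \prod_(i <- l) p (u i).
Variables (xi : C -> R) (eps : nat -> R).
Hypothesis xi_mean0 : \sum_v p v * xi v = 0.
Hypothesis xi_var_le1 : \sum_v p v * xi v ^+ 2 <= 1.

Fixpoint exceeds (lam : R) n s a x : bool :=
  (lam <= `|a|) || (if n is n'.+1 then
    exceeds lam n' s.+1 (a + eps s * xi (c s x)) x else false).

Let exceeds_meas lam n s a : measurable [set x | exceeds lam n s a x].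
Proof.
elim: n s a => [|n IHn] s a /=; case: (lam <= `|a|) => //=.
- by rewrite (_ : [set _ | _] = setT) //; apply/seteqP; split.
- by rewrite (_ : [set _ | _] = set0) //; apply/seteqP; split.
- by rewrite (_ : [set _ | _] = setT) //; apply/seteqP; split.
exact: (measurable_fiberwise (F := fun v =>
  [set x | exceeds lam n s.+1 (a + eps s * xi v) x])).
Qed.

Let cyl_meas (l : seq nat) (u : nat -> C) :
  measurable (\bigcap_(i in [set` l]) (c i @^-1` [set u i])).
Proof.
by apply: bigcap_measurableType => i _; exact: c_meas.
Qed.

Let p_ge0 v : 0 <= p v.
Proof.
have := c_indep (l := [:: 0%N]) (fun=> v) isT; rewrite big_seq1 => <-.
by rewrite fine_ge0.
Qed.

Let p_sum1 : \sum_v p v = 1.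
Proof.
have := fine_prob_partition P (c_meas 0) (@measurableT _ T).
rewrite probability_setT /= => ->; apply: eq_bigr => v _.
have := c_indep (l := [:: 0%N]) (fun=> v) isT; rewrite big_seq1 => <-.
congr (fine (P _)); rewrite setTI; apply/seteqP; split=> x.
  by move=> /(_ 0%N); apply; rewrite /= inE.
by move=> cx i; rewrite /= inE => /eqP ->.
Qed.

(* Conditioning on the first increment turns the bound for [n.+1] steps from
   [a] into an average of the bounds for [n] steps from the shifted values of
   [a]; the cross term vanishes because the increments are centred. *)
Lemma kolmogorov_maximal lam n s a (l : seq nat) (u : nat -> C) :
  0 < lam -> uniq l -> all (fun i => i < s)%N l ->
  fine (P ((\bigcap_(i in [set` l]) (c i @^-1` [set u i])) `&`
           [set x | exceeds lam n s a x])) <=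
  \prod_(i <- l) p (u i) *
    ((a ^+ 2 + \sum_(s <= i < s + n) eps i ^+ 2) / lam ^+ 2).
Proof.
move=> lam0; elim: n s a l u => [|n IHn] s a l u l_uniq ls.
all: have pl0 : 0 <= \prod_(i <- l) p (u i) by apply: prodr_ge0.
all: have [lam_a|a_lam] := leP lam `|a|.
1,3: rewrite [X in _ `&` X](_ : _ = setT) ?setIT ?c_indep //;
  last (by apply/seteqP; split=> //= x _; rewrite ?lam_a).
1,2: rewrite ler_peMr // ler_pdivlMr ?exprn_gt0 // mul1r.
1,2: rewrite -[leLHS]addr0 lerD ?sumr_ge0 //; last by move=> *; rewrite sqr_ge0.
1,2: by rewrite -(real_normK (num_real a)) ler_pXn2r ?nnegrE // ltW.
- rewrite [X in _ `&` X](_ : _ = set0); last first.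
    by apply/seteqP; split=> //= x; rewrite leNgt a_lam.
  rewrite setI0 measure0 mulr_ge0 // divr_ge0 ?sqr_ge0 //.
  by rewrite addr_ge0 ?sqr_ge0 // sumr_ge0 // => *; rewrite sqr_ge0.
rewrite (fine_prob_partition P (c_meas s)); last exact: measurableI.
pose u' v i := if i == s then v else u i.
have u's v : u' v s = v by rewrite /u' eqxx.
have sl : s \notin l.
  by apply/negP => /(allP ls); rewrite ltnn.
have step v : fine (P ((\bigcap_(i in [set` l]) (c i @^-1` [set u i])) `&`
      [set x | exceeds lam n.+1 s a x] `&` c s @^-1` [set v])) <=
    p v * \prod_(i <- l) p (u i) * (((a + eps s * xi v) ^+ 2 +
      \sum_(s.+1 <= i < s + n.+1) eps i ^+ 2) / lam ^+ 2).
  have := IHn s.+1 (a + eps s * xi v) (s :: l) (u' v).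
  rewrite /= sl l_uniq leqnn /=.
  have -> : all (fun i => i < s.+1)%N l.
    by apply/allP => i /(allP ls) /ltnW.
  rewrite big_cons u's addSnnS => /(_ isT isT).
  rewrite (eq_big_seq (fun i => p (u i))); last first.
    by move=> i il; rewrite /u'; case: eqP il sl => // -> ->.
  apply: le_trans; rewrite le_eqVlt; apply/orP; left; apply/eqP.
  congr (fine (P _)); apply/seteqP; split=> x /=.
    move=> [[cl]]; rewrite leNgt a_lam /= => ex cs; split; last by rewrite -cs.
    move=> i; rewrite /= inE /u' => /predU1P[->|il]; first by rewrite eqxx.
    by case: eqP => [->//|_]; apply: cl.
  move=> [cl ex]; have cs : c s x = v.
    by have := cl s; rewrite /= inE /u' eqxx; apply.
  split=> //; split; last by rewrite leNgt a_lam /= cs.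
  move=> i il; have := cl i; rewrite /= inE il orbT /u' => /(_ isT).
  by case: eqP il sl => // -> ->.
apply: le_trans (ler_sum _ (fun v _ => step v)) _.
rewrite (big_ltn (m := s)); last by rewrite addnS ltnS leq_addr.
set r := \sum_(_ <= _ < _) _; set q := \prod_(_ <- _) _.
have -> : \sum_v p v * q * (((a + eps s * xi v) ^+ 2 + r) / lam ^+ 2) =
   q / lam ^+ 2 * ((a ^+ 2 + r) * (\sum_v p v) + 2 * a * eps s * (\sum_v p v *
     xi v)
     + eps s ^+ 2 * (\sum_v p v * xi v ^+ 2)).
  by rewrite !mulr_sumr -!big_split /= mulr_sumr; apply: eq_bigr => v _; ring.
rewrite p_sum1 xi_mean0.
have -> : q * ((a ^+ 2 + (eps s ^+ 2 + r)) / lam ^+ 2) =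
  q / lam ^+ 2 * (a ^+ 2 + (eps s ^+ 2 + r)) by ring.
rewrite ler_wpM2l ?divr_ge0 ?sqr_ge0 //.
have := ler_wpM2l (sqr_ge0 (eps s)) xi_var_le1; lra.
Qed.

Let exceedsS lam n s a x : exceeds lam n s a x -> exceeds lam n.+1 s a x.
Proof.
elim: n s a => [|n IHn] s a /=; first by rewrite orbF => ->.
by case: (lam <= _) => //= /IHn.
Qed.

Let not_exceeds lam n s a x : ~~ exceeds lam n s a x ->
  `|a + \sum_(s <= i < s + n) eps i * xi (c i x)| < lam.
Proof.
elim: n s a => [|n IHn] s a /=.
  by rewrite orbF addn0 big_geq // addr0 ltNge.
rewrite negb_or => /andP[_ /IHn].
by rewrite (big_ltn (m := s)) ?addnS ?ltnS ?leq_addr // addrA addSn.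
Qed.

Hypothesis eps2_cvg : cvgn (series (fun t => eps t ^+ 2)).

Let tail s := limn (series (fun t => eps t ^+ 2)) - series (fun t => eps t ^+
  2) s.

Let tail_ge s n : \sum_(s <= i < s + n) eps i ^+ 2 <= tail s.
Proof.
have nd : nondecreasing_seq (series (fun t => eps t ^+ 2)).
  by apply/nondecreasing_series => i _ _; rewrite sqr_ge0.
have := nondecreasing_cvgn_le nd eps2_cvg (s + n)%N.
rewrite /tail /series /= [X in X <= _](big_cat_nat (n := s)) ?leq_addr //=; lra.
Qed.

Let tail_cvg0 : tail @ \oo --> 0.
Proof.
rewrite -(subrr (limn (series (fun t => eps t ^+ 2)))).
by apply: cvgB; [exact: cvg_cst|exact: eps2_cvg].
Qed.

Let ever lam s := \bigcup_n [set x | exceeds lam n s 0 x].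
Let bad lam := \bigcap_s ever lam s.

Let bad_negligible lam : 0 < lam -> P.-negligible (bad lam).
Proof.
move=> lam0.
have mU s : measurable (ever lam s).
  by apply: bigcupT_measurable => n; exact: exceeds_meas.
have mbad : measurable (bad lam) by apply: bigcapT_measurable.
have PU s : (P (ever lam s) <= (tail s / lam ^+ 2)%:E)%E.
  have cvgU : (fun n => P [set x | exceeds lam n s 0 x]) @ \oo -->
      P (ever lam s).
    apply: (nondecreasing_cvg_mu (F := fun n => [set x | exceeds lam n s 0 x])).
    - by move=> n; exact: exceeds_meas.
    - exact: mU.
    move=> n m /subnKC <-; rewrite subsetEset => x /= nx.
    elim: (m - n)%N => [|k IHk]; first by rewrite addn0.
    by rewrite addnS; exact: exceedsS.
  rewrite -(cvg_lim _ cvgU) //; apply: lime_le; first by apply/cvg_ex; eexists;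
    exact: cvgU.
  apply: nearW => n; rewrite -[X in (X <= _)%E]fineK ?fin_num_measure // lee_fin.
  have [v0 _] : exists v : C, True.
    apply: contrapT => noC; have := p_sum1; rewrite big1 => [|v _].
      by move/eqP; rewrite eq_sym oner_eq0.
    by exfalso; apply: noC; exists v.
  have := kolmogorov_maximal n (s := s) 0 (l := [::]) (fun=> v0) lam0 isT isT.
  rewrite big_nil mul1r expr0n add0r set_nil bigcap_set0 setTI.
  by move=> /le_trans; apply; rewrite ler_wpM2r ?invr_ge0 ?sqr_ge0.
apply/negligibleP => //; apply/eqP; rewrite eq_le measure_ge0 andbT.
rewrite -[X in (X <= _)%E]fineK ?fin_num_measure // lee_fin.
apply/ler_addgt0Pr => e e0; rewrite add0r.
have [s _ /(_ s (leqnn s)) tail_s] : \forall s \near \oo, `|tail s| <= e * lam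
  ^+ 2.
  by apply: cvgr0_norm_le => //; rewrite mulr_gt0 // exprn_gt0.
rewrite -lee_fin fineK ?fin_num_measure //.
apply: (@le_trans _ _ (P (ever lam s))).
  by apply: le_measure; rewrite ?inE // => x; apply.
rewrite (le_trans (PU s)) // lee_fin ler_pdivrMr ?exprn_gt0 //.
by rewrite (le_trans (ler_norm _)).
Qed.

Lemma ae_cvg_centered_series :
  {ae P, forall x, cvgn (fun n => \sum_(0 <= t < n) eps t * xi (c t x))}.
Proof.
apply: (negligibleS (A := \bigcup_j bad (j.+1%:R^-1))); last first.
  by apply: negligible_bigcup => j; apply: bad_negligible; rewrite invr_gt0.
move=> x /= ncv; apply: contrapT => good; apply: ncv.
apply/cauchy_cvgP; apply: cauchy_exP => e e0.
have [j je] : exists j : nat, j.+1%:R^-1 < e :> R.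
  exists (Num.bound e^-1); rewrite invf_plt ?posrE //.
  rewrite (lt_trans (archi_boundP _)) ?invr_ge0 1?ltW //.
  by rewrite ltr_nat.
have [s Hs] : exists s, forall n, ~~ exceeds j.+1%:R^-1 n s 0 x.
  apply: contrapT => H; apply: good; exists j => // s _.
  apply: contrapT => H2; apply: H; exists s => n; apply/negP => En.
  by apply: H2; exists n.
exists (\sum_(0 <= t < s) eps t * xi (c t x)); exists s => // n /= sn.
rewrite -ball_normE /= distrC (big_cat_nat (n := s)) //= addrAC subrr add0r.
have := not_exceeds (Hs (n - s)%N); rewrite add0r subnKC // => h;
  exact: lt_trans h je.
Qed.

End Kolmogorov.

(** * Random variables with values in [nat] *)

Section NatRV.
Variables (R : realType) (d : measure_display) (T : measurableType d).
Variable (P : probability T R).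
Implicit Types X Y : {RV P >-> nat}.

Lemma measurable_natRV X (A : set nat) : measurable (X @^-1` A).
Proof. by rewrite -[_ @^-1` _]setTI; exact: measurable_funPT. Qed.

Lemma prob_natRV_bigcup X (A : set nat) : P (X @^-1` A) =
  (\sum_(0 <= a <oo | a \in A) P (X @^-1` [set a]))%E.
Proof.
rewrite -measure_bigcup; last 2 first.
- by move=> a _; exact: measurable_natRV.
- by move=> a b _ _ [x [/= Xa Xb]]; rewrite -Xa -Xb.
congr (P _); apply/seteqP; split=> [x Ax|x [a Aa /= Xa]]; last by rewrite /= Xa.
by exists (X x).
Qed.

Lemma eq_law_natRV X Y :
  (forall a, P (X @^-1` [set a]) = P (Y @^-1` [set a])) ->
  forall A, P (X @^-1` A) = P (Y @^-1` A).
Proof.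
move=> XY A; rewrite !prob_natRV_bigcup.
by apply: eq_eseriesr => a _; rewrite XY.
Qed.

Lemma nneseries_finite_image X (C : finType) (h : nat -> C) (f : C -> R) :
  (\sum_(0 <= a <oo) (fine (P (X @^-1` [set a])) * f (h a))%:E =
   (\sum_v fine (P (X @^-1` [set a | h a = v])) * f v)%:E)%E.
Proof.
have cvg_v v : \sum_(0 <= a < n) fine (P (X @^-1` [set a])) * (h a == v)%:R
    @[n --> \oo] --> fine (P (X @^-1` [set a | h a = v])).
  apply: (fine_cvg (f := fun n => (\sum_(0 <= a < n)
    fine (P (X @^-1` [set a])) * (h a == v)%:R)%:E)).
  rewrite fineK ?fin_num_measure //; last exact: measurable_natRV.
  rewrite prob_natRV_bigcup.
  have -> : (fun n => (\sum_(0 <= a < n) fine (P (X @^-1` [set a])) * (h a ==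
    v)%:R)%:E)
    = (fun n => \sum_(0 <= a < n | a \in [set a | h a = v]) P (X @^-1` [set
      a]))%E.
    apply/funext => n; rewrite -sumEFin [RHS]big_mkcond; apply: eq_bigr => a _.
    rewrite (_ : (a \in _) = (h a == v)); last first.
      by apply/idP/eqP; rewrite inE.
    rewrite EFinM fineK ?fin_num_measure //; last exact: measurable_natRV.
    by case: eqP; rewrite ?mule1 ?mule0.
  exact: is_cvg_nneseries_cond.
apply: cvg_lim => //.
have -> : (fun n => \sum_(0 <= a < n) (fine (P (X @^-1` [set a])) * f (h
  a))%:E)%E =
  (fun n => (\sum_v (\sum_(0 <= a < n) fine (P (X @^-1` [set a])) * (h a ==
    v)%:R) * f v)%:E).
  apply/funext => n; rewrite sumEFin; congr (_%:E).
  under [RHS]eq_bigr do rewrite mulr_suml.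
  rewrite exchange_big /=; apply: eq_bigr => a _.
  rewrite (bigD1 (h a)) //= eqxx mulr1 big1 ?addr0 // => v /negbTE va.
  by rewrite eq_sym va mulr0 mul0r.
apply: cvg_EFin; first by apply: nearW.
by apply: (cvg_big add_continuous) => v _; apply: cvgMr_tmp.
Qed.

Lemma prob_natRV_eq0_gt0 X : (\int[P]_x (X x)%:R%:E < 1)%E ->
  0 < fine (P (X @^-1` [set 0%N])).
Proof.
move=> EX; rewrite lt_neqAle fine_ge0 // andbT; apply/eqP => PX0.
have mX0 := measurable_natRV X [set 0%N].
move: EX; apply/negP; rewrite -leNgt.
have -> : 1%E = P (~` (X @^-1` [set 0%N])).
  by rewrite probability_setC // -[P (X @^-1` _)]fineK ?fin_num_measure // -PX0
    sube0.
rewrite -[X in P X]setIT -integral_indic //; last exact: measurableC.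
apply: ge0_le_integral => //.
- by apply/measurable_EFinP; apply: measurable_indic; exact: measurableC.
- move=> _ A _; rewrite setTI.
  exact: (measurable_natRV X [set n | A n%:R%:E]).
- move=> x _; rewrite lee_fin indicE.
  case: (boolP (x \in _)) => // xX; rewrite ler1n lt0n; apply/eqP.
  by move: xX; rewrite inE.
Qed.

Lemma natRV_atom X (C : finType) (h : nat -> C) (A : set nat) :
  (0 < P (X @^-1` A))%E ->
  exists2 n, A n & 0 < fine (P (X @^-1` [set a | h a = h n])).
Proof.
move=> PA; have mX := measurable_natRV X.
have : 0 < fine (P (X @^-1` A)).
  by apply: fine_gt0; rewrite PA ltey_eq fin_num_measure.
rewrite (fine_prob_partition (c := h \o X) P) // => [|v];
  last exact: (mX [set a | h a = v]).
move=> sum_gt0; apply: contrapT => none; move: sum_gt0; apply/negP.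
rewrite -leNgt; apply: sumr_le0 => v _.
have [[n [An hn]]|noA] := pselect (exists n, A n /\ h n = v); last first.
  rewrite (_ : _ `&` _ = set0) ?measure0 //; apply/seteqP; split=> // x [Ax hx].
  by apply: noA; exists (X x).
have : ~ 0 < fine (P (X @^-1` [set a | h a = h n])) by move=> ?; apply: none;
  exists n.
move/negP; rewrite -leNgt; apply: le_trans; apply: fine_le.
- by rewrite fin_num_measure //; apply: measurableI => //;
  exact: (mX [set a | h a = v]).
- by rewrite fin_num_measure.
apply: le_measure; rewrite ?inE //.
  by apply: measurableI => //; exact: (mX [set a | h a = v]).
by move=> x [_ /= hx]; rewrite /= hn.
Qed.

End NatRV.

(** * The arrivals and the decisions of a flow *)

Section Flow.
Variables (R : realType) (d : measure_display) (T : measurableType d).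
Variables (P : probability T R) (S : system R) (X : processes P S).
Variable w : csi S -> dtx S -> sched S -> beams S.
Variables (Om : base_policy S) (k : 'I_(nMS S)).

Let b := serving k.

Definition arrival : finType := (battery S * buffer S)%type.
Definition decision : finType := (csi S * sched S * dtx S)%type.

Definition clipped_arrival (t : nat) (x : T) : arrival :=
  (clipE S (arrE X b t x), clipQ S (arrQ X k t x)).

Definition probE_clip (v : battery S) : R :=
  fine (P (arrE X b 0 @^-1` [set a | clipE S a = v])).
Definition probQ_clip (v : buffer S) : R :=
  fine (P (arrQ X k 0 @^-1` [set a | clipQ S a = v])).
Definition arrival_prob (c : arrival) : R := probE_clip c.1 * probQ_clip c.2.

Definition decision_prob (a : decision) : R :=
  csi_prob X a.1.1 * pol_sched Om a.1.1 a.1.2 * pol_dtx Om a.2.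

Lemma clipE_val n : clipE S n = minn n (maxE S) :> nat.
Proof. by rewrite inordK // ltnS geq_minr. Qed.

Lemma clipQ_val n : clipQ S n = minn n (maxQ S) :> nat.
Proof. by rewrite inordK // ltnS geq_minr. Qed.

Lemma clipE_addl m n : clipE S (clipE S m + n)%N = clipE S (m + n)%N.
Proof. by apply: val_inj; rewrite /= !clipE_val; lia. Qed.

Lemma clipE_addr m n : clipE S (m + clipE S n)%N = clipE S (m + n)%N.
Proof. by apply: val_inj; rewrite /= !clipE_val; lia. Qed.

Lemma clipQ_addl m n : clipQ S (clipQ S m + n)%N = clipQ S (m + n)%N.
Proof. by apply: val_inj; rewrite /= !clipQ_val; lia. Qed.

Lemma clipQ_addr m n : clipQ S (m + clipQ S n)%N = clipQ S (m + n)%N.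
Proof. by apply: val_inj; rewrite /= !clipQ_val; lia. Qed.

Lemma clipped_arrival_meas t v : measurable (clipped_arrival t @^-1` [set v]).
Proof.
case: v => v1 v2; rewrite (_ : _ @^-1` _ =
    arrE X b t @^-1` [set a | clipE S a = v1] `&`
    arrQ X k t @^-1` [set a | clipQ S a = v2]); last first.
  by apply/seteqP; split=> x /= => [[]|[<- <-]].
by apply: measurableI; exact: measurable_natRV.
Qed.

Lemma clipped_arrival_indep (l : seq nat) (u : nat -> arrival) : uniq l ->
  fine (P (\bigcap_(i in [set` l]) (clipped_arrival i @^-1` [set u i]))) =
  \prod_(i <- l) arrival_prob (u i).
Proof.
move=> l_uniq.
pose idx : seq (('I_(nMS S) + 'I_(nBS S)) * nat) :=
  [seq (inr b, i) | i <- l] ++ [seq (inl k, i) | i <- l].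
pose A (j : ('I_(nMS S) + 'I_(nBS S)) * nat) : set nat :=
  if j.1 is inl _ then [set a | clipQ S a = (u j.2).2]
  else [set a | clipE S a = (u j.2).1].
have idx_uniq : uniq idx.
  rewrite cat_uniq !map_inj_uniq ?l_uniq //=; try by move=> i j [].
  by rewrite andbT; apply/hasPn => _ /mapP[i _ ->]; apply/mapP => -[].
have := arr_indep X A idx_uniq; rewrite big_cat !big_map /= -big_split /=.
rewrite (_ : \bigcap_(i in [set` idx]) _ =
    \bigcap_(i in [set` l]) (clipped_arrival i @^-1` [set u i])); last first.
  apply/seteqP; split=> x /= H.
    move=> i il; have /= HE := H (inr b, i); have /= HQ := H (inl k, i).
    rewrite /= [RHS]surjective_pairing /clipped_arrival HE ?HQ //.
      by rewrite /idx mem_cat (map_f (fun i => (inl k, i))) ?orbT.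
    by rewrite /idx mem_cat (map_f (fun i => (inr b, i))).
  move=> j; rewrite /= mem_cat => /orP[] /mapP[i il ->]; rewrite /A /=.
    by have <- := H i il.
  by have <- := H i il.
move=> ->; apply: eq_bigr => i _; rewrite /arrival_prob; congr (fine _ * fine _).
  exact: eq_law_natRV (arrE_iid X b i) _.
exact: eq_law_natRV (arrQ_iid X k i) _.
Qed.

Lemma arrival_prob_ge0 c : 0 <= arrival_prob c.
Proof. by rewrite mulr_ge0 // fine_ge0. Qed.

Lemma arrival_probE c :
  arrival_prob c = fine (P (clipped_arrival 0 @^-1` [set c])).
Proof.
have := clipped_arrival_indep (fun=> c) (isT : uniq [:: 0%N]).
rewrite big_seq1 => <-; congr (fine (P _)); apply/seteqP; split=> x.
  by move=> /(_ 0%N); apply; rewrite /= inE.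
by move=> cx i; rewrite /= inE => /eqP ->.
Qed.

Lemma arrival_prob_sum1 : \sum_c arrival_prob c = 1.
Proof.
have := fine_prob_partition P (clipped_arrival_meas 0) (@measurableT _ T).
rewrite probability_setT /= => ->; apply: eq_bigr => c _.
by rewrite arrival_probE setTI.
Qed.

Lemma prob_clipped_arrival (phi : arrival -> bool) :
  fine (P [set x | phi (clipped_arrival 0 x)]) =
  \sum_c arrival_prob c * (phi c)%:R.
Proof.
have m0 := clipped_arrival_meas 0.
rewrite (fine_prob_partition P m0); last first.
  apply: (measurable_fiberwise m0 (F := fun c => [set x | phi c])) => c.
  by case: (phi c); [rewrite (_ : mkset _ = setT)|rewrite (_ : mkset _ = set0)]
    => //;
    apply/seteqP; split.
apply: eq_bigr => c _; rewrite arrival_probE.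
case: (boolP (phi c)) => phic.
  rewrite mulr1; congr (fine (P _)); apply/seteqP; split=> [x [] //|x /= cx].
  by split => //; rewrite /= cx.
rewrite mulr0 (_ : _ `&` _ = set0) ?measure0 //; apply/seteqP; split=> // x [] /=.
by move=> + cx; rewrite cx (negbTE phic).
Qed.

Lemma csi_prob_ge0 h : 0 <= csi_prob X h.
Proof. exact: fine_ge0. Qed.

Lemma csi_prob_sum1 : \sum_h csi_prob X h = 1.
Proof.
pose c0 x : csi S := [ffun i => fade X i.1 i.2 0 x].
have c0E h : c0 @^-1` [set h] = [set x | forall k b, fade X k b 0 x = h (k, b)].
  apply/seteqP; split=> x /=; first by move=> <- k' b'; rewrite ffunE.
  by move=> H; apply/ffunP => -[k' b']; rewrite ffunE H.
have mc0 h : measurable (c0 @^-1` [set h]).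
  rewrite (_ : _ @^-1` _ = \bigcap_(i in [set: 'I_(nMS S) * 'I_(nBS S)])
      (fade X i.1 i.2 0 @^-1` [set h i])); last first.
    rewrite c0E; apply/seteqP; split=> x /= H; first by move=> [k' b'] _;
      exact: H.
    by move=> k' b'; exact: (H (k', b')).
  by apply: fin_bigcap_measurable => // i _; exact: fade_meas.
have := fine_prob_partition P mc0 (@measurableT _ T).
rewrite probability_setT /= => ->; apply: eq_bigr => h _.
by rewrite setTI c0E.
Qed.

Lemma pol_dtx_ge0 p : 0 <= pol_dtx Om p.
Proof. by have [] := pol_dtx_distr Om. Qed.

Lemma pol_dtx_sum1 : \sum_p pol_dtx Om p = 1.
Proof. by have [] := pol_dtx_distr Om. Qed.

Lemma pol_sched_ge0 h s : 0 <= pol_sched Om h s.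
Proof. by have [] := pol_sched_distr Om h. Qed.

Lemma pol_sched_sum1 h : \sum_s pol_sched Om h s = 1.
Proof. by have [] := pol_sched_distr Om h. Qed.

Lemma decision_prob_ge0 a : 0 <= decision_prob a.
Proof. by rewrite !mulr_ge0 ?pol_dtx_ge0 ?pol_sched_ge0 ?csi_prob_ge0. Qed.

Lemma sum_decision (F : decision -> R) :
  \sum_a decision_prob a * F a =
  mean_dtx Om (fun p => mean_csi_sched X Om (fun h s => F (h, s, p))).
Proof.
pose G h s p := decision_prob (h, s, p) * F (h, s, p).
rewrite (eq_bigr (fun a : decision => G a.1.1 a.1.2 a.2)); last by case=> -[].
rewrite -(pair_bigA _ (fun hs p => G hs.1 hs.2 p)) /=.
rewrite exchange_big /=; apply: eq_bigr => p _.
rewrite -(pair_bigA _ (fun h s => G h s p)) /=.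
rewrite mulr_sumr; apply: eq_bigr => h _; rewrite !mulr_sumr.
by apply: eq_bigr => s _; rewrite /G /decision_prob /=; ring.
Qed.

Lemma mean_dtx_cst c : mean_dtx Om (fun=> c) = c.
Proof. by rewrite /mean_dtx -mulr_suml pol_dtx_sum1 mul1r. Qed.

Lemma mean_csi_sched_cst c : mean_csi_sched X Om (fun _ _ => c) = c.
Proof.
rewrite /mean_csi_sched.
under eq_bigr => h _ do rewrite -mulr_suml pol_sched_sum1 mul1r.
by rewrite -mulr_suml csi_prob_sum1 mul1r.
Qed.

Lemma decision_prob_sum1 : \sum_a decision_prob a = 1.
Proof.
under eq_bigr do rewrite -[decision_prob _]mulr1.
by rewrite sum_decision -[RHS](mean_dtx_cst 1) mean_csi_sched_cst.
Qed.

Lemma mean_csi_sched_sum (I : finType) (phi : I -> csi S -> sched S -> R)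
    (f : I -> R) :
  \sum_i mean_csi_sched X Om (phi i) * f i =
  mean_csi_sched X Om (fun h s => \sum_i phi i h s * f i).
Proof.
rewrite /mean_csi_sched; under eq_bigr do rewrite mulr_suml.
rewrite exchange_big; apply: eq_bigr => h _.
under eq_bigr do rewrite -mulrA mulr_suml.
rewrite -mulr_sumr exchange_big; congr (_ * _); apply: eq_bigr => s _.
by rewrite mulr_sumr; apply: eq_bigr => i _; rewrite mulrA.
Qed.

Lemma mean_dtx_sum (I : finType) (phi : I -> dtx S -> R) (f : I -> R) :
  \sum_i mean_dtx Om (phi i) * f i =
  mean_dtx Om (fun p => \sum_i phi i p * f i).
Proof.
rewrite /mean_dtx; under eq_bigr do rewrite mulr_suml.
rewrite exchange_big; apply: eq_bigr => p _.
by rewrite mulr_sumr; apply: eq_bigr => i _; rewrite mulrA.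
Qed.

Lemma sum_prob_post e q p (f : battery S -> buffer S -> R) :
  \sum_e' \sum_q' prob_post X w Om k e q p e' q' * f e' q' =
  mean_csi_sched X Om (fun h s =>
    f (clipE S (served_E k e p)) (clipQ S (served_Q w k q h p s))).
Proof.
rewrite (pair_bigA _ (fun e' q' => prob_post X w Om k e q p e' q' * f e' q')) /=.
rewrite (mean_csi_sched_sum (fun (u : battery S * buffer S) h s =>
  ((served_E k e p == u.1 :> nat) && (served_Q w k q h p s == u.2 :> nat))%:R)
  (fun u => f u.1 u.2)).
congr (mean_csi_sched X Om _); apply/funext => h; apply/funext => s.
set e1 := served_E k e p; set q1 := served_Q w k q h p s.
have e1E : clipE S e1 = e1 :> nat.
  by rewrite clipE_val /e1 /served_E; have := ltn_ord e; lia.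
have q1E : clipQ S q1 = q1 :> nat.
  by rewrite clipQ_val /q1 /served_Q; have := ltn_ord q; lia.
rewrite (bigD1 (clipE S e1, clipQ S q1)) //= e1E q1E !eqxx mul1r big1 ?addr0 //.
move=> [e2 q2] /= ne; case: eqP => [ee|_]; last by rewrite mul0r.
case: eqP => [qq|_]; last by rewrite mul0r.
move: ne; have -> : clipE S e1 = e2 by apply: val_inj; rewrite /= e1E.
by have -> : clipQ S q1 = q2; [apply: val_inj; rewrite /= q1E|rewrite eqxx].
Qed.

End Flow.

(** * The updates and the fixed point equations *)

Section Operators.
Variables (R : realType) (d : measure_display) (T : measurableType d).
Variables (P : probability T R) (S : system R) (X : processes P S).
Variable w : csi S -> dtx S -> sched S -> beams S.
Variables (Om : base_policy S) (k : 'I_(nMS S)).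

Definition flow_state : finType := (battery S * buffer S)%type.
Definition flow_pair : finType := (battery S * buffer S * dtx S)%type.

Definition Q_move (c : arrival S) (a : decision S) (i : flow_pair) : flow_pair :=
  (clipE S (served_E k i.1.1 i.2 + c.1)%N,
   clipQ S (served_Q w k i.1.2 a.1.1 i.2 a.1.2 + c.2)%N, a.2).

Definition U_move (c : arrival S) (a : decision S) (i : flow_state) :
  flow_state :=
  let et := clipE S (i.1 + c.1)%N in let qt := clipQ S (i.2 + c.2)%N in
  (clipE S (served_E k et a.2), clipQ S (served_Q w k qt a.1.1 a.2 a.1.2)).

Definition Q_cost (c : arrival S) (i : flow_pair) : R :=
  ghat X Om k i.1.1 i.1.2 i.2.

Definition U_cost (c : arrival S) (i : flow_state) : R :=
  mean_dtx Om (fun p => ghat X Om k (clipE S (i.1 + c.1)%N) (clipQ S (i.2 +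
    c.2)%N) p).

Let mu := decision_prob X Om.
Let pc := arrival_prob X k.
Let clipped aE aQ : arrival S := (clipE S aE, clipQ S aQ).

Lemma average_Q_move c (x : flow_pair -> R) i :
  average mu (Q_move c) x i = mean_csi_sched X Om (fun h s => mean_dtx Om (fun
    p =>
    x (clipE S (served_E k i.1.1 i.2 + c.1)%N,
       clipQ S (served_Q w k i.1.2 h i.2 s + c.2)%N, p))).
Proof.
rewrite /average (sum_decision X Om (fun a => x (Q_move c a i))).
rewrite /mean_dtx /mean_csi_sched; under eq_bigr do rewrite mulr_sumr.
rewrite exchange_big; apply: eq_bigr => h _ /=.
under eq_bigr do rewrite mulrCA mulr_sumr.
rewrite -mulr_sumr exchange_big; congr (_ * _); apply: eq_bigr => s _.
by rewrite mulr_sumr; apply: eq_bigr => p _; rewrite mulrCA.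
Qed.

Lemma average_U_move c (x : flow_state -> R) i :
  average mu (U_move c) x i = mean_dtx Om (fun p => mean_csi_sched X Om (fun h
    s =>
    x (clipE S (served_E k (clipE S (i.1 + c.1)%N) p),
       clipQ S (served_Q w k (clipQ S (i.2 + c.2)%N) h p s)))).
Proof. by rewrite /average (sum_decision X Om (fun a => x (U_move c a i))). Qed.

Lemma F_opE aE aQ (Q : Qfactor S) e q p :
  F_op X w Om k aE aQ Q e q p =
  backup mu Q_move Q_cost (clipped aE aQ) (fun i => Q i.1.1 i.1.2 i.2) (e, q, p).
Proof.
rewrite /F_op /backup average_Q_move /Q_cost /=; congr (_ + _).
rewrite (sum_prob_post X w Om k e q p (fun e' q' => mean_dtx Om (fun p' =>
  Q (clipE S (e' + aE)%N) (clipQ S (q' + aQ)%N) p'))).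
congr (mean_csi_sched X Om _); apply/funext => h; apply/funext => s.
congr (mean_dtx Om _); apply/funext => p'; congr (Q _ _ _).
  by rewrite clipE_addl clipE_addr.
by rewrite clipQ_addl clipQ_addr.
Qed.

Lemma T_opE aE aQ (U : potential S) e q :
  T_op X w Om k aE aQ U e q =
  backup mu U_move U_cost (clipped aE aQ) (fun i => U i.1 i.2) (e, q).
Proof.
rewrite /T_op /backup average_U_move /U_cost /= clipE_addr clipQ_addr.
congr (_ + _).
rewrite (pair_bigA _ (fun e' q' => mean_dtx Om (fun p =>
  prob_post X w Om k (clipE S (e + aE)%N) (clipQ S (q + aQ)%N) p e' q') * U e'
    q')) /=.
rewrite (mean_dtx_sum Om (fun (u : battery S * buffer S) p => prob_post X w Om k
  (clipE S (e + aE)%N) (clipQ S (q + aQ)%N) p u.1 u.2) (fun u => U u.1 u.2)).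
congr (mean_dtx Om _); apply/funext => p.
rewrite -(pair_bigA _ (fun e' q' => prob_post X w Om k _ _ p e' q' * U e' q')) /=.
exact: sum_prob_post.
Qed.

Lemma sum_prob_next e q p (f : battery S -> buffer S -> R) :
  \sum_e' \sum_q' prob_next X w Om k e q p e' q' * f e' q' =
  \sum_c pc c * mean_csi_sched X Om (fun h s =>
    f (clipE S (served_E k e p + c.1)%N) (clipQ S (served_Q w k q h p s +
      c.2)%N)).
Proof.
rewrite (pair_bigA _ (fun e' q' => prob_next X w Om k e q p e' q' * f e' q')) /=.
pose tgt h s (c : arrival S) : arrival S :=
  (clipE S (served_E k e p + c.1)%N, clipQ S (served_Q w k q h p s + c.2)%N).
transitivity (\sum_u mean_csi_sched X Om
    (fun h s => \sum_c pc c * (tgt h s c == u)%:R) * f u.1 u.2).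
  apply: eq_bigr => -[e' q'] _; congr (_ * _); congr (mean_csi_sched X Om _).
  apply/funext => h; apply/funext => s.
  rewrite -(prob_clipped_arrival X k (fun c => tgt h s c == (e', q'))).
  congr (fine (P _)); apply/seteqP; split=> x /=;
    rewrite /tgt /clipped_arrival /=.
    by move=> [<- <-]; rewrite clipE_addr clipQ_addr.
  by rewrite clipE_addr clipQ_addr => /eqP[-> ->].
rewrite (mean_csi_sched_sum X Om (fun u h s => \sum_c pc c * (tgt h s c == u)%:R)
  (fun u : arrival S => f u.1 u.2)).
transitivity (mean_csi_sched X Om (fun h s => \sum_c pc c * f (tgt h s c).1
  (tgt h s c).2)).
  congr (mean_csi_sched X Om _); apply/funext => h; apply/funext => s.
  under eq_bigr do rewrite mulr_suml.
  rewrite exchange_big; apply: eq_bigr => c _ /=.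
  rewrite (bigD1 (tgt h s c)) //= eqxx mulr1 big1 ?addr0 // => u /negbTE uc.
  by rewrite eq_sym uc mulr0 mul0r.
under [RHS]eq_bigr do rewrite mulrC.
rewrite (mean_csi_sched_sum X Om (fun (c : arrival S) h s =>
  f (clipE S (served_E k e p + c.1)%N) (clipQ S (served_Q w k q h p s +
    c.2)%N)) pc).
congr (mean_csi_sched X Om _); apply/funext => h; apply/funext => s.
by apply: eq_bigr => c _; rewrite mulrC.
Qed.


Let h_U (i : flow_state) : R := \sum_c pc c * U_cost c i.
Let pc_ge0 := arrival_prob_ge0 X k.
Let pc_sum1 := arrival_prob_sum1 X k.
Let mu_ge0 := decision_prob_ge0 X Om.
Let mu_sum1 := decision_prob_sum1 X Om.
Let i0 : flow_state := (refE S, refQ S).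
Let u0 : flow_pair := (refE S, refQ S, refp S).

Lemma U_poisson_solvable j0 :
  (forall i, connect (step (joint_weight pc mu) (joint_move U_move)) i j0) ->
  exists (theta : R) (U : flow_state -> R), U i0 = 0 /\
    forall i, theta + U i = \sum_c pc c * backup mu U_move U_cost c U i.
Proof.
move=> reach; have [theta [U [U0 HU]]] := poisson_solvable
  (joint_weight_ge0 pc_ge0 mu_ge0) (joint_weight_sum1 pc_sum1 mu_sum1) i0 reach
    h_U.
exists theta, U; split=> // i; rewrite HU average_joint /h_U -big_split /=.
by apply: eq_bigr => c _; rewrite /backup mulrDr.
Qed.

(* A Q-factor is recovered from the potential function by one decision step
   without arrivals, which is why both equations share the same constant. *)
Lemma Q_poisson_solvable theta (U : flow_state -> R) :
  (forall i, theta + U i = \sum_c pc c * backup mu U_move U_cost c U i) ->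
  exists2 Q : flow_pair -> R, Q u0 = 0 &
    forall i, theta + Q i = \sum_c pc c * backup mu Q_move Q_cost c Q i.
Proof.
move=> HU.
pose post h s (e : battery S) (q : buffer S) p : flow_state :=
  (clipE S (served_E k e p), clipQ S (served_Q w k q h p s)).
pose Q1 (i : flow_pair) := ghat X Om k i.1.1 i.1.2 i.2 +
  mean_csi_sched X Om (fun h s => U (post h s i.1.1 i.1.2 i.2)) - theta.
have mean_Q1 (i : flow_state) :
    U i = \sum_c pc c * mean_dtx Om (fun p =>
      Q1 (clipE S (i.1 + c.1)%N, clipQ S (i.2 + c.2)%N, p)).
  have -> : U i = theta + U i - 1 * theta by ring.
  rewrite HU -pc_sum1.
  rewrite mulr_suml -sumrB; apply: eq_bigr => c _.
  rewrite -mulrBr; congr (_ * _); rewrite /backup average_U_move /U_cost.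
  rewrite -[X in _ - X](mean_dtx_cst Om) /mean_dtx -big_split -sumrB.
  by apply: eq_bigr => p _; rewrite /Q1 /post /=; ring.
have Q1E i : theta + Q1 i = \sum_c pc c * backup mu Q_move Q_cost c Q1 i.
  under eq_bigr do rewrite /backup mulrDr.
  rewrite big_split /= /Q_cost -mulr_suml pc_sum1 mul1r.
  rewrite /Q1 [LHS]addrC subrK; congr (_ + _).
  under [RHS]eq_bigr do rewrite average_Q_move mulrC.
  rewrite (mean_csi_sched_sum X Om (fun (c : arrival S) h s => mean_dtx Om (fun
    p =>
    Q1 (clipE S (served_E k i.1.1 i.2 + c.1)%N,
        clipQ S (served_Q w k i.1.2 h i.2 s + c.2)%N, p))) pc).
  congr (mean_csi_sched X Om _); apply/funext => h; apply/funext => s.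
  rewrite mean_Q1; apply: eq_bigr => c _; rewrite mulrC; congr (_ * _).
  by rewrite /post /= clipE_addl clipQ_addl.
exists (fun i => Q1 i - Q1 u0); first by rewrite subrr.
move=> i; rewrite addrA Q1E -[X in _ - X]mul1r -pc_sum1 mulr_suml -sumrB.
apply: eq_bigr => c _; rewrite -mulrBr /backup -addrA; congr (_ * (_ + _)).
have -> : (fun j => Q1 j - Q1 u0) = (fun j => 1 * Q1 j + 0 * 0 + - Q1 u0).
  by apply/funext => j; rewrite mul1r mul0r addr0.
rewrite (average_comb (Q_move c) mu_sum1 Q1 (fun=> 0)); ring.
Qed.

Lemma Q_fixed_point_of_poisson theta (Q : flow_pair -> R) :
  (forall i, theta + Q i = \sum_c pc c * backup mu Q_move Q_cost c Q i) ->
  Q_fixed_point X w Om k theta (fun e q p => Q (e, q, p)).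
Proof.
move=> HQ e q p _; rewrite HQ; under eq_bigr do rewrite /backup mulrDr.
rewrite big_split /= /Q_cost -mulr_suml pc_sum1 mul1r; congr (_ + _).
rewrite (sum_prob_next e q p (fun e' q' => mean_dtx Om (fun p' => Q (e', q',
  p')))).
by apply: eq_bigr => c _; rewrite average_Q_move.
Qed.

Lemma U_fixed_point_of_poisson theta (U : flow_state -> R) :
  (forall i, theta + U i = \sum_c pc c * backup mu U_move U_cost c U i) ->
  U_fixed_point X w Om k theta (fun e q => U (e, q)).
Proof.
move=> HU e q; rewrite HU.
pose G c := backup mu U_move U_cost c U (e, q).
have TE aE aQ : T_op X w Om k aE aQ (fun e q => U (e, q)) e q = G (clipped aE aQ).
  by rewrite T_opE; congr (backup _ _ _ _ _ _); apply/funext => -[].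
transitivity (\sum_(0 <= aE <oo) (probE X k aE *
    (\sum_v probQ_clip X k v * G (clipE S aE, v)))%:E)%E.
  rewrite /probE (nneseries_finite_image (arrE X (serving k) 0) (clipE S)
    (fun v => \sum_v' probQ_clip X k v' * G (v, v'))).
  congr (_%:E); rewrite -(pair_bigA _ (fun v v' => pc (v, v') * G (v, v'))) /=.
  apply: eq_bigr => v _; rewrite mulr_sumr; apply: eq_bigr => v' _.
  by rewrite /pc /arrival_prob /= mulrA.
apply: eq_eseriesr => aE _; rewrite mulr_sumr.
rewrite (eq_bigr (fun v => probQ_clip X k v * (probE X k aE * G (clipE S aE,
  v)))).
  rewrite -(nneseries_finite_image (arrQ X k 0) (clipQ S)
    (fun v => probE X k aE * G (clipE S aE, v))).
  by apply: eq_eseriesr => aQ _; rewrite TE /probQ; congr (_%:E); ring.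
by move=> v _; ring.
Qed.

End Operators.

(** * Reachability *)

Lemma sumr_gt0_exists (R : realDomainType) (I : finType) (F : I -> R) :
  0 < \sum_i F i -> exists i, 0 < F i.
Proof.
move=> F0; apply/existsP; rewrite -[X in is_true X]negbK negb_exists;
  apply/negP => /forallP nF.
by move: F0; rewrite ltNge sumr_le0 // => i _; rewrite leNgt nF.
Qed.

Definition target_dist (down : bool) (M x : nat) : nat :=
  if down then x else (M - x)%N.

Lemma target_dist_idle down M x (r : bool) v : (x <= M)%N -> v = 0%N ->
  (down || ~~ r) ->
  (target_dist down M (minn (x - r + v) M) <= target_dist down M x)%N &&
  (target_dist down M (minn (minn (x + v) M - r) M) <= target_dist down M x)%N.
Proof. by move=> xM ->; rewrite /target_dist; case: down; case: r => //=;
  lia. Qed.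

Lemma target_dist_progress down M x (r : bool) v : (x <= M)%N ->
  (0 < target_dist down M x)%N ->
  (if down then r && (v == 0%N) else ~~ r && (0 < v)%N) ->
  (target_dist down M (minn (x - r + v) M) < target_dist down M x)%N &&
  (target_dist down M (minn (minn (x + v) M - r) M) < target_dist down M x)%N.
Proof. by move=> xM; rewrite /target_dist; case: down; case: r => //=; lia. Qed.

Section Reachability.
Variables (R : realType) (d : measure_display) (T : measurableType d).
Variables (P : probability T R) (S : system R) (X : processes P S).
Variable w : csi S -> dtx S -> sched S -> beams S.
Variables (Om : base_policy S) (k : 'I_(nMS S)).
Hypothesis not_frozen_k : not_frozen X w Om k.

Let b := serving k.
Let mu := decision_prob X Om.
Let pc := arrival_prob X k.

Let rE (a : decision S) : bool := a.2 b.
Let rQ (a : decision S) : bool := received w a.1.1 a.2 a.1.2 k.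
Let drained := [exists a, (0 < mu a) && rE a].
Let served := [exists a, (0 < mu a) && rQ a].

Let distE (e : battery S) := target_dist drained (maxE S) e.
Let distQ (q : buffer S) := target_dist served (maxQ S) q.

Let exists_decision (phi : decision S -> bool) :
  0 < \sum_a mu a * (phi a)%:R -> exists a, (0 < mu a) && phi a.
Proof.
case/sumr_gt0_exists => a; case: (boolP (phi a)) => pa;
  last by rewrite mulr0 ltxx.
by rewrite mulr1 => a0; exists a; rewrite a0.
Qed.

Let some_decision : exists a, 0 < mu a.
Proof.
by apply: sumr_gt0_exists; rewrite decision_prob_sum1.
Qed.

Let probE0 : 0 < probE_clip X k (clipE S 0).
Proof.
have PX0 := prob_natRV_eq0_gt0 (arrE_mean X b).
have [|n /= -> //] := natRV_atom (X := arrE X b 0) (clipE S) (A := [set 0%N])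
  (P := P).
by rewrite -[X in (_ < X)%E]fineK ?lte_fin // fin_num_measure //;
  exact: measurable_natRV.
Qed.

Let probQ0 : 0 < probQ_clip X k (clipQ S 0).
Proof.
have PX0 := prob_natRV_eq0_gt0 (arrQ_mean X k).
have [|n /= -> //] := natRV_atom (X := arrQ X k 0) (clipQ S) (A := [set 0%N])
  (P := P).
by rewrite -[X in (_ < X)%E]fineK ?lte_fin // fin_num_measure //;
  exact: measurable_natRV.
Qed.

Let idleE a : 0 < mu a -> drained || ~~ rE a.
Proof. by move=> a0; case: (boolP (rE a)) => ra; rewrite orbC //=;
  apply/existsP; exists a; rewrite a0. Qed.

Let idleQ a : 0 < mu a -> served || ~~ rQ a.
Proof. by move=> a0; case: (boolP (rQ a)) => ra; rewrite orbC //=;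
  apply/existsP; exists a; rewrite a0. Qed.

Let progressE e : (0 < distE e)%N -> exists n a, [/\ 0 < probE_clip X k (clipE
  S n),
  0 < mu a & if drained then rE a && (clipE S n == 0%N :> nat)
             else ~~ rE a && (0 < clipE S n)%N].
Proof.
rewrite /distE /target_dist; case: (boolP drained) => [/existsP[a /andP[a0 ra]]
  _|ndr eM].
  by exists 0%N, a; split=> //; rewrite ra clipE_val min0n.
have [_ [arrE0|]] := not_frozen_k; last first.
  rewrite -[X in 0 < X](_ : \sum_a mu a * (rE a)%:R = _); last first.
    by rewrite (sum_decision X Om (fun a => (rE a)%:R)); congr (mean_dtx Om _);
      apply/funext => p; rewrite mean_csi_sched_cst.
  by move/exists_decision => dr; case/negP: ndr; apply/existsP.
have [n /= n0 Pn] := natRV_atom (X := arrE X b 0) (A := [set n | (0 < n)%N])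
  (clipE S) arrE0.
have [a a0] := some_decision; exists n, a; split=> //.
by have := idleE a0; rewrite (negbTE ndr) /= => ->; rewrite clipE_val; lia.
Qed.

Let progressQ q : (0 < distQ q)%N -> exists n a, [/\ 0 < probQ_clip X k (clipQ
  S n),
  0 < mu a & if served then rQ a && (clipQ S n == 0%N :> nat)
             else ~~ rQ a && (0 < clipQ S n)%N].
Proof.
rewrite /distQ /target_dist; case: (boolP served) => [/existsP[a /andP[a0 ra]]
  _|ndr qM].
  by exists 0%N, a; split=> //; rewrite ra clipQ_val min0n.
have [[arrQ0|serv] _] := not_frozen_k; last first.
  move: serv; rewrite -(sum_decision X Om (fun a => (rQ a)%:R)).
  by move/exists_decision => dr; case/negP: ndr; apply/existsP.
have [n /= n0 Pn] := natRV_atom (X := arrQ X k 0) (A := [set n | (0 < n)%N])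
  (clipQ S) arrQ0.
have [a a0] := some_decision; exists n, a; split=> //.
by have := idleQ a0; rewrite (negbTE ndr) /= => ->; rewrite clipQ_val; lia.
Qed.

Let dist (i : flow_state S) := (distE i.1 + distQ i.2)%N.

Let good_step i : (0 < dist i)%N -> exists c a, [/\ 0 < pc c, 0 < mu a,
  (dist (U_move w k c a i) < dist i)%N & forall p',
  (dist (Q_move w k c (a.1, p') (i, a.2)).1 < dist i)%N].
Proof.
have E_le := fun v r => @target_dist_idle drained (maxE S) i.1 r v (leq_ord i.1).
have Q_le := fun v r => @target_dist_idle served (maxQ S) i.2 r v (leq_ord i.2).
have E0 : clipE S 0 = 0%N :> nat by rewrite clipE_val min0n.
have Q0 : clipQ S 0 = 0%N :> nat by rewrite clipQ_val min0n.
rewrite /dist addn_gt0 => /orP[/[dup] i1|/[dup] i2].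
  move=> /progressE[n [a [n0 a0 prog]]]; exists (clipE S n, clipQ S 0), a.
  have := target_dist_progress (leq_ord i.1) i1 prog.
  have := Q_le _ (rQ a) Q0 (idleQ a0).
  rewrite /distE /distQ /U_move /Q_move /= /served_E /served_Q !clipE_val
    !clipQ_val.
  move=> /andP[? ?] /andP[? ?]; split=> [|//||p']; first exact: mulr_gt0.
    by rewrite -addSn leq_add.
  by rewrite -addSn leq_add.
move=> /progressQ[n [a [n0 a0 prog]]]; exists (clipE S 0, clipQ S n), a.
have := target_dist_progress (leq_ord i.2) i2 prog.
have := E_le _ (rE a) E0 (idleE a0).
rewrite /distE /distQ /U_move /Q_move /= /served_E /served_Q !clipE_val
  !clipQ_val.
move=> /andP[? ?] /andP[? ?]; split=> [|//||p']; first exact: mulr_gt0.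
  by rewrite -addnS leq_add.
by rewrite -addnS leq_add.
Qed.

Let target : flow_state S :=
  (if drained then ord0 else ord_max, if served then ord0 else ord_max).

Let dist_eq0 i : dist i = 0%N -> i = target.
Proof.
case: i => e q; rewrite /dist /distE /distQ /target_dist /target /=.
have := leq_ord e; have := leq_ord q.
by case: drained; case: served => qM eM eq0; congr (_, _);
  apply: val_inj => /=; lia.
Qed.

Lemma U_reach i :
  connect (step (joint_weight pc mu) (joint_move (U_move w k))) i target.
Proof.
have [n] := ubnP (dist i); elim: n i => // n IHn i; rewrite ltnS => i_n.
have [/dist_eq0 ->|] := posnP (dist i); first exact: connect0.
move=> /good_step[c [a [c0 a0 lt_i _]]].
apply: (connect_trans (connect1 _) (IHn (U_move w k c a i) (leq_trans lt_i i_n))).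
by apply/existsP; exists (c, a); rewrite /joint_weight mulr_gt0 //= eqxx.
Qed.

Let mu_factors h s p : 0 < mu (h, s, p) ->
  0 < csi_prob X h * pol_sched Om h s /\ 0 < pol_dtx Om p.
Proof.
have := pol_dtx_ge0 Om p; have := mulr_ge0 (csi_prob_ge0 X h) (pol_sched_ge0 Om
  h s).
rewrite /mu /decision_prob /= !le0r => /predU1P[->|h0] /predU1P[->|p0];
  by rewrite ?mul0r ?mulr0 ?ltxx.
Qed.

Lemma Q_reach : exists j0, forall i : flow_pair S,
  connect (step (joint_weight pc mu) (joint_move (Q_move w k))) i j0.
Proof.
have [[[h0 s0] p0] a0] := some_decision; have [hs0 pd0] := mu_factors a0.
have mu_gt0 h s p : 0 < csi_prob X h * pol_sched Om h s -> 0 < pol_dtx Om p ->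
  0 < mu (h, s, p) by move=> *; exact: mulr_gt0.
have from_state (i : flow_state S) : exists2 p, 0 < pol_dtx Om p &
    connect (step (joint_weight pc mu) (joint_move (Q_move w k))) (i, p)
      (target, p0).
  have [n] := ubnP (dist i); elim: n i => // n IHn i; rewrite ltnS => i_n.
  have [/dist_eq0 ->|] := posnP (dist i); first by exists p0.
  move=> /good_step[c [[[h s] p] [c0 a1 _ lt_i]]].
  have [p' p'0 Hp'] := IHn _ (leq_trans (lt_i p) i_n).
  have [hs p1] := mu_factors a1.
  exists p => //; apply: connect_trans (connect1 _) Hp'.
  apply/existsP; exists (c, (h, s, p')).
  by apply/andP; split; [apply: mulr_gt0 => //; exact: mu_gt0|exact/eqP].
exists (target, p0) => -[i p].
have [p' p'0 Hp'] := from_state (Q_move w k (clipE S 0, clipQ S 0) (h0, s0, p0)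
  (i, p)).1.
apply: connect_trans (connect1 _) Hp'.
apply/existsP; exists ((clipE S 0, clipQ S 0), (h0, s0, p')).
apply/andP; split; last exact/eqP.
by apply: mulr_gt0; [exact: mulr_gt0|exact: mu_gt0].
Qed.

End Reachability.

(** * Almost sure convergence *)

Lemma cvg0_of_square_summable (R : realType) (eps : nat -> R) :
  (forall t, 0 <= eps t) -> cvgn (series (fun t => eps t ^+ 2)) ->
  eps @ \oo --> 0.
Proof.
move=> eps0 /cvg_series_cvg_0 sq0; apply/cvgrPdist_le => e e0; near=> t.
have : `|eps t ^+ 2| <= e ^+ 2.
  by near: t; apply: cvgr0_norm_le => //; rewrite exprn_gt0.
by rewrite sub0r normrN normrX ler_pXn2r ?nnegrE // ltW.
Unshelve. all: by end_near.
Qed.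

Lemma partial_sums_unbounded (R : realType) (eps : nat -> R) :
  (forall t, 0 <= eps t) -> (\sum_(0 <= t <oo) (eps t)%:E = +oo)%E ->
  forall M, exists n, M <= \sum_(0 <= t < n) eps t.
Proof.
move=> eps0 eps_oo M; apply: contrapT => no.
suff : (\sum_(0 <= t <oo) (eps t)%:E <= M%:E)%E by rewrite eps_oo.
apply: lime_le; first by apply: is_cvg_nneseries => n _ _; rewrite lee_fin.
apply: nearW => n; rewrite sumEFin lee_fin leNgt; apply/negP => lt_n.
by apply: no; exists n; exact: ltW.
Qed.

Lemma ae_noise_cvg (R : realType) (d : measure_display) (T : measurableType d)
    (P : probability T R) (S : system R) (X : processes P S) (k : 'I_(nMS S))
    (eps : nat -> R) : cvgn (series (fun t => eps t ^+ 2)) ->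
  {ae P, forall x, forall c, cvgn (fun n => \sum_(0 <= t < n)
    eps t * ((clipped_arrival X k t x == c)%:R - arrival_prob X k c))}.
Proof.
move=> eps2; apply: filter_forall => c.
have p0 := arrival_prob_ge0 X k; have p1 := arrival_prob_sum1 X k.
have pc1 : arrival_prob X k c <= 1 by rewrite -p1 (bigD1 c) //= lerDl sumr_ge0.
apply: (ae_cvg_centered_series (clipped_arrival_meas X k)
  (clipped_arrival_indep X k)
  (xi := fun v => (v == c)%:R - arrival_prob X k c)) => //.
  under eq_bigr do rewrite mulrBr.
  rewrite sumrB -mulr_suml p1 mul1r (bigD1 c) //= eqxx mulr1 big1 ?addr0 ?subrr
    //.
  by move=> v /negbTE ->; rewrite mulr0.
rewrite -[leRHS]p1; apply: ler_sum => v _; rewrite ler_piMr //.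
by have := p0 c; case: (v == c) => pc0; rewrite /=; nra.
Qed.

Theorem lemma5 (R : realType) (d : measure_display) (T : measurableType d)
    (P : probability T R) (S : system R) (X : processes P S)
    (w : csi S -> dtx S -> sched S -> beams S) (Om : base_policy S)
    (eps : nat -> R)
    (Q0 : 'I_(nMS S) -> Qfactor S) (U0 : 'I_(nMS S) -> potential S)
    (w_zf : zero_forcing w)
    (servableP : forall k, servable X w k)
    (not_frozenP : forall k, not_frozen X w Om k)
    (eps_ge0 : forall t, 0 <= eps t)
    (eps_sum : (\sum_(0 <= t <oo) (eps t)%:E = +oo)%E)
    (eps_sum2 : (\sum_(0 <= t <oo) (eps t ^+ 2)%:E < +oo)%E)
    (k : 'I_(nMS S)) :
  exists (theta : R) (Qinf : Qfactor S) (Uinf : potential S),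
    [/\ Q_fixed_point X w Om k theta Qinf,
        U_fixed_point X w Om k theta Uinf,
        {ae P, forall x, forall e q p, p \in dtx_actions S ->
           Q_iter X w Om eps k (fun t => arrE X (serving k) t x)
             (fun t => arrQ X k t x) (Q0 k) t e q p
             @[t --> \oo] --> Qinf e q p}
      & {ae P, forall x, forall e q,
           U_iter X w Om eps k (fun t => arrE X (serving k) t x)
             (fun t => arrQ X k t x) (U0 k) t e q
             @[t --> \oo] --> Uinf e q}].
Proof.
have eps2_cvg : cvgn (series (fun t => eps t ^+ 2)).
  by apply: nnseries_is_cvg => // t; rewrite sqr_ge0.
have eps_cvg0 := cvg0_of_square_summable eps_ge0 eps2_cvg.
have eps_unbounded := partial_sums_unbounded eps_ge0 eps_sum.
have pc_ge0 := arrival_prob_ge0 X k; have pc_sum1 := arrival_prob_sum1 X k.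
have mu_ge0 := decision_prob_ge0 X Om; have mu_sum1 := decision_prob_sum1 X Om.
have U_reach_k := U_reach (not_frozenP k).
have [j0 Q_reach_k] := Q_reach (not_frozenP k).
have [theta [U [Uref HU]]] := U_poisson_solvable U_reach_k.
have [Q Qref HQ] := Q_poisson_solvable HU.
exists theta, (fun e q p => Q (e, q, p)), (fun e q => U (e, q)); split.
- exact: Q_fixed_point_of_poisson.
- exact: U_fixed_point_of_poisson.
- apply: filterS (ae_noise_cvg X k eps2_cvg) => x noise e q p _.
  pose x_ t (i : flow_pair S) := Q_iter X w Om eps k (fun t => arrE X (serving
    k) t x)
    (fun t => arrQ X k t x) (Q0 k) t i.1.1 i.1.2 i.2.
  have x_step t i : x_ t.+1 i = x_ t i + eps t *
      (backup (decision_prob X Om) (Q_move w k) (Q_cost X Om k)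
        (clipped_arrival X k t x) (x_ t) i -
       backup (decision_prob X Om) (Q_move w k) (Q_cost X Om k)
         (clipped_arrival X k t x) (x_ t)
         (refE S, refQ S, refp S) - x_ t i).
    by case: i => -[e' q'] p'; rewrite /x_ /= !F_opE.
  exact: (relative_value_iteration_cvg pc_ge0 pc_sum1 mu_ge0 mu_sum1 Q_reach_k HQ
    Qref eps_ge0 eps_cvg0 eps_unbounded noise x_step).
apply: filterS (ae_noise_cvg X k eps2_cvg) => x noise e q.
pose x_ t (i : flow_state S) := U_iter X w Om eps k (fun t => arrE X (serving
  k) t x)
  (fun t => arrQ X k t x) (U0 k) t i.1 i.2.
have x_step t i : x_ t.+1 i = x_ t i + eps t *
    (backup (decision_prob X Om) (U_move w k) (U_cost X Om k) (clipped_arrival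
      X k t x) (x_ t) i -
     backup (decision_prob X Om) (U_move w k) (U_cost X Om k) (clipped_arrival
       X k t x) (x_ t)
       (refE S, refQ S) - x_ t i).
  by case: i => e' q'; rewrite /x_ /= !T_opE.
exact: (relative_value_iteration_cvg pc_ge0 pc_sum1 mu_ge0 mu_sum1 U_reach_k HU
  Uref eps_ge0 eps_cvg0 eps_unbounded noise x_step).
Qed.
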